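(* Let $T$ be a power bounded operator acting on a complex Hilbert space $H$ with $\sigma_p(T)\cap\mathbb{T}=\emptyset$, let $g$ be a real continuous function defined on some interval $[t_1,\infty)$ which satisfies property $(Q)$, and let $f\in P_m$ for some $m\in\mathbb{N}$. Then for every $x\in H$ $$ \lim_{N\to\infty}\frac{1}{N}\sum_{n=1}^N e^{2\pi i g(n)}T^{[f(n)]}x=0 $$ in the norm of $H$; that is, these averages converge to $0$ in the strong operator topology.
   Context: $\mathbb{T}$ is the unit circle in $\mathbb{C}$, $\sigma_p(T)$ is the set of eigenvalues of $T$, $T$ is power bounded if $\sup_{n\ge0}\|T^n\|<\infty$, $[\cdot]$ applied to a real number is the integer part, and for integers $a\le b$, $[a,b]$ denotes the set of integers $n$ with $a\le n\le b$. Convention: $T^{[f(n)]}=I$ if the exponent is negative or $f(n)$ is not defined; the finitely many $n$ for which $g(n)$ is not defined are irrelevant (put, e.g., the corresponding weight equal to $1$). A set $A\subset\mathbb{N}$ has density $\operatorname{dens}A$ if $\lim_{n\to\infty}\operatorname{card}(A\cap[1,n])/n=\operatorname{dens}A$ exists. A set $A\subset\mathbb{N}$ is regular if it has density $\operatorname{dens}A>0$ and, for all $K\in\mathbb{N}$ and each $B\subset[0,K]$, the set $\{n\in\mathbb{N}: n+j\in A\Leftrightarrow j\in B\ (j=0,\dots,K)\}$ has density (positive or zero). Property $(Q)$: $g$ satisfies $(Q)$ if for each interval (arc) $I\subset\mathbb{T}$ of positive length the set $\{n\in\mathbb{N}: e^{2\pi i g(n)}\in I\}$ is regular. Class $P_m$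 ($m\in\mathbb{N}$, $m\ge1$): a continuous real function $f$ defined on some interval $[t_0,\infty)$ (functions agreeing for all large $t$ are identified) is of class $P_m$ if, for all $t$ large enough, $f$ has continuous derivatives $f',\dots,f^{(m)}$ with $f,f',\dots,f^{(m)}>0$, and $$\limsup_{t\to\infty}\frac{f^{(m-1)}(t)}{t f^{(m)}(t)}<\infty,\qquad \limsup_{t\to\infty}\sup\Bigl\{\frac{f^{(m)}(s)}{f^{(m)}(t)}: s\ge t\Bigr\}<\infty.$$ *)

(* Defs.v *)
From mathcomp Require Export all_boot all_order all_algebra.
From mathcomp Require Export sesquilinear complex.
From mathcomp Require Export all_classical all_reals all_analysis.

Set Implicit Arguments.
Unset Strict Implicit.
Unset Printing Implicit Defensive.

Import Order.TTheory GRing.Theory Num.Theory.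
Import numFieldNormedType.Exports.

Local Open Scope classical_set_scope.
Local Open Scope ring_scope.

Section Operators.
Context {R : realType} {H : normedModType R[i]}.
Implicit Types (T : H -> H) (x : H).

(* Norms of H take values in R[i]; they are nonnegative, hence real. *)
Definition opnorm T : \bar R :=
  ereal_sup [set (complex.Re `|T x|)%:E | x in [set x | `|x| <= 1]].

Definition power_bounded T : Prop :=
  (ereal_sup (range (fun n : nat => opnorm (iter n T))) < +oo)%E.

Definition point_spectrum T : set R[i] :=
  [set lambda | exists2 x, x != 0 & T x = lambda *: x].

(* T^k for k >= 0, and the identity for k < 0 (by convention, not T^-1). *)
Definition iterz (k : int) T x : H :=
  if k is Posz n then iter n T x else x.

End Operators.

Section Weights.
Context {R : realType}.

Definition unit_circle : set R[i] := [set z | `|z| = 1].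

(* e^(2 pi i t) *)
Definition expi2pi (t : R) : R[i] :=
  Complex (cos (2 * pi * t)) (sin (2 * pi * t)).

(* Arcs of positive length, with or without their end points; an interval J of
   length > 1 gives the whole circle. *)
Definition is_arc (I : set R[i]) : Prop :=
  exists J : set R, [/\ is_interval J,
    exists a b : R, [/\ J a, J b & a < b] & I = expi2pi @` J].

Definition has_density (A : set nat) (d : R) : Prop :=
  (count (fun k => k \in A) (iota 1 n))%:R / n%:R @[n --> \oo] --> d.

Definition regular_set (A : set nat) : Prop :=
  (exists2 d : R, 0 < d & has_density A d) /\
  forall (K : nat) (B : set nat), B `<=` [set j | (j <= K)%N] ->
    exists d : R, has_density
      [set n | forall j, (j <= K)%N -> (A (n + j)%N <-> B j)] d.

(* A function on [t1, +oo[ is a total function R -> R whose values on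
   ]-oo, t1[ are ignored. *)
Definition property_Q (t1 : R) (g : R -> R) : Prop :=
  forall I : set R[i], is_arc I ->
    regular_set [set n | t1 <= n%:R /\ I (expi2pi (g n%:R))].

Definition class_P (m : nat) (t0 : R) (f : R -> R) : Prop :=
  [/\ {within `[t0, +oo[, continuous f},
      \forall t \near +oo,
        (forall k, (k < m)%N -> derivable (derive1n k f) t 1) /\
        (forall k, (k <= m)%N ->
           {for t, continuous (derive1n k f)} /\ 0 < derive1n k f t),
      (limf_esup (fun t => (derive1n m.-1 f t / (t * derive1n m f t))%:E)
         (pinfty_nbhs R) < +oo)%E &
      (limf_esup (fun t =>
         ereal_sup [set (derive1n m f s / derive1n m f t)%:E | s in `[t, +oo[])
         (pinfty_nbhs R) < +oo)%E].

(* Outside the domain of g, resp. f, the weight is 1, resp. the power of T is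
   the identity. *)
Definition weight (t1 : R) (g : R -> R) (n : nat) : R[i] :=
  if t1 <= n%:R then expi2pi (g n%:R) else 1.

Definition floor_power (H : normedModType R[i]) (T : H -> H) (t0 : R)
    (f : R -> R) (n : nat) (x : H) : H :=
  if t0 <= n%:R then iterz (Num.floor (f n%:R)) T x else x.

End Weights.

(* Main.v *)
Require Import Defs.
From mathcomp Require Import ring lra zify.
Import Order.TTheory GRing.Theory Num.Theory.
Import numFieldNormedType.Exports.
Set Implicit Arguments.
Unset Strict Implicit.
Unset Printing Implicit Defensive.
Local Open Scope classical_set_scope.
Local Open Scope ring_scope.
Local Open Scope complex_scope.

(** Call an exponent sequence a null if the norm of N^-1 sum_(n < N) c_n T^(a n) x
    tends to 0 uniformly in the weights c of modulus at most 1; the integer parts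
    of f n form a null sequence.

    The sequence a n = n is null.  By the mean ergodic theorem, applied to every
    rotation lambda T, and compactness of the circle, the averages of
    lambda^n T^n x are small uniformly in lambda.  A far block T^j y is dominated
    by the quadratic mean of the norms of T^i y, i < P, since T is power bounded;
    on the periodic extension of the orbit this mean is governed by the
    autocorrelations, which the discrete Fourier transform bounds by the averages
    of lambda^n T^n x.

    A van der Corput argument, in which the same averaging over translates makes
    up for T not being an isometry, shows that a is null as soon as all the
    sequences a (n + h) - a n are null and a grows slowly enough on [K, kK].
    Since f (t + h) - f t is in P_(m-1) when f is in P_m, an induction on m
    reduces to P_1, where equal values of the integer part of f are grouped and
    the case a n = n applies. *)

(** The only comparison that power boundedness offers is one-sided: T^j y is at most M times T^i y
    in norm when i <= j. An inner product of two orbit points therefore cannot be reduced to one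
    that depends on the difference of the exponents alone. What can be shifted is a mean over a long
    window of exponents, where a shift affects only the two ends. Each use thus needs a window that
    is long compared with the shift: a period P against a block length N when a n = n, and the
    length a K against a (n + h) - a n in the van der Corput step. The latter explains why the bound
    t f'(t) = O(f(t)) has to be extracted from the condition on the top derivatives, and why sums
    are cut at K with N < kK: all exponents are then at least a K, f stays within a constant factor
    of f K, and the omitted initial part costs about 1/k. *)

Ltac ilra := move=> *; lra.

Section Archimedean.
Context {R : realType}.

Lemma nat_gt (x : R) : exists n : nat, x < n%:R.
Proof. by exists (Num.trunc x).+1; exact: truncnS_gt. Qed.

Lemma inv_nat_lt (e : R) : 0 < e -> exists n : nat, n.+1%:R^-1 < e.
Proof.
move=> e0; have [n ne] := nat_gt e^-1; exists n.
rewrite invf_plt ?posrE // (lt_trans ne) // ltr_nat //.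
Qed.

End Archimedean.

(** * Real-valued norm and real inner product on [H] *)

Section RealNorm.
Context {R : realType}.

Definition rnorm (V : normedZmodType R[i]) (x : V) : R := complex.Re `|x|.

Lemma rnormE (V : normedZmodType R[i]) (x : V) : `|x| = (rnorm x)%:C.
Proof. by rewrite /rnorm RRe_real. Qed.

Lemma rnorm_ge0 (V : normedZmodType R[i]) (x : V) : 0 <= rnorm x.
Proof. by rewrite -ler0c -rnormE. Qed.

Lemma rnorm0 (V : normedZmodType R[i]) : rnorm (0 : V) = 0.
Proof. by rewrite /rnorm normr0. Qed.

Lemma rnorm0_eq0 (V : normedZmodType R[i]) (x : V) : rnorm x = 0 -> x = 0.
Proof. by move=> x0; apply/normr0_eq0; rewrite rnormE x0. Qed.

Lemma rnormD (V : normedZmodType R[i]) (x y : V) :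
  rnorm (x + y) <= rnorm x + rnorm y.
Proof. by rewrite -lecR rmorphD /= -!rnormE ler_normD. Qed.

Lemma rnormN (V : normedZmodType R[i]) (x : V) : rnorm (- x) = rnorm x.
Proof. by rewrite /rnorm normrN. Qed.

Lemma rdistC (V : normedZmodType R[i]) (x y : V) : rnorm (x - y) = rnorm (y - x).
Proof. by rewrite /rnorm distrC. Qed.

Lemma rnormB (V : normedZmodType R[i]) (x y : V) :
  rnorm (x - y) <= rnorm x + rnorm y.
Proof. by rewrite (le_trans (rnormD _ _)) ?rnormN. Qed.

Lemma rnormZ (V : normedModType R[i]) (c : R[i]) (x : V) :
  rnorm (c *: x) = rnorm c * rnorm x.
Proof. by apply: complexI; rewrite rmorphM /= -!rnormE normrZ. Qed.

Lemma rnormM (c d : R[i]) : rnorm (c * d) = rnorm c * rnorm d.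
Proof. by apply: complexI; rewrite rmorphM /= -!rnormE normrM. Qed.

Lemma rnorm_conj (c : R[i]) : rnorm (c^* )%R = rnorm c.
Proof. by rewrite /rnorm norm_conjC. Qed.

Lemma rnormC (r : R) : rnorm (r%:C) = `|r|.
Proof.
by rewrite /rnorm normc_def /= expr0n /= addr0 sqrtr_sqr.
Qed.

Lemma rnormZr (V : normedModType R[i]) (r : R) (x : V) :
  0 <= r -> rnorm (r%:C *: x) = r * rnorm x.
Proof. by move=> r0; rewrite rnormZ rnormC ger0_norm. Qed.

Lemma rnorm1 : rnorm (1 : R[i]) = 1.
Proof. by rewrite /rnorm normr1. Qed.

Lemma rnormX (c : R[i]) n : rnorm c = 1 -> rnorm (c ^+ n) = 1.
Proof.
by move=> c1; elim: n => [|n ih]; rewrite ?rnorm1 // exprS rnormM c1 ih mul1r.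
Qed.

Lemma rnorm_sum (V : normedZmodType R[i]) I (r : seq I) (P : pred I)
    (F : I -> V) :
  rnorm (\sum_(i <- r | P i) F i) <= \sum_(i <- r | P i) rnorm (F i).
Proof.
elim/big_ind2: _ => [||//]; first by rewrite rnorm0.
by move=> x1 x2 y1 y2 h1 h2; rewrite (le_trans (rnormD _ _)) // lerD.
Qed.

Lemma rnorm_sum_le (V : normedZmodType R[i]) (m n : nat) (P : pred nat)
    (F : nat -> V) (B : R) : 0 <= B ->
  (forall i, (m <= i < n)%N -> P i -> rnorm (F i) <= B) ->
  rnorm (\sum_(m <= i < n | P i) F i) <= (n - m)%:R * B.
Proof.
move=> B0 FB; apply: (le_trans (rnorm_sum _ _ _)).
rewrite big_mkcond /= -[_ * B](_ : \sum_(m <= i < n) B = _); last first.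
  by rewrite sumr_const_nat mulr_natl.
rewrite !big_nat; apply: ler_sum => i imn; case: ifP => // Pi; exact: FB.
Qed.

Lemma rnorm_le (V : normedZmodType R[i]) (x : V) (r : R) :
  (rnorm x <= r) = (`|x| <= r%:C).
Proof. by rewrite rnormE lecR. Qed.

End RealNorm.

Ltac nneg := repeat first [done | assumption | exact: sqr_ge0 | exact: rnorm_ge0
  | exact: ltW | apply: mulr_ge0 | apply: addr_ge0 | rewrite invr_ge0].

Section InnerProduct.
Context {R : realType} {H : normedModType R[i]} (dotp : {dot H for Num.conj}).
Hypothesis dotpE : forall x : H, `|x| ^+ 2 = dotp x x.
Implicit Types x y z : H.

Definition rdot x y : R := complex.Re (dotp x y).

Lemma sqr_rnorm x : rnorm x ^+ 2 = rdot x x.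
Proof. by rewrite /rdot -dotpE rnormE -rmorphXn. Qed.

Lemma dotpC x y : dotp x y = ((dotp y x)^* )%R.
Proof. by rewrite hermC expr0 mul1r. Qed.

Lemma rdotC x y : rdot x y = rdot y x.
Proof. by rewrite /rdot dotpC; case: (dotp y x). Qed.

Lemma rdotDl x y z : rdot (x + y) z = rdot x z + rdot y z.
Proof. by rewrite /rdot linearDl /= raddfD. Qed.

Lemma rdotDr x y z : rdot z (x + y) = rdot z x + rdot z y.
Proof. by rewrite rdotC rdotDl !(rdotC z). Qed.

Lemma rdot0l x : rdot 0 x = 0.
Proof. by rewrite /rdot linear0l. Qed.

Lemma rdot_suml I (r : seq I) (P : pred I) (F : I -> H) y :
  rdot (\sum_(i <- r | P i) F i) y = \sum_(i <- r | P i) rdot (F i) y.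
Proof.
by apply: (big_morph (fun x => rdot x y)) => [u v|]; rewrite ?rdotDl ?rdot0l.
Qed.

Lemma rdot_sumr I (r : seq I) (P : pred I) (F : I -> H) y :
  rdot y (\sum_(i <- r | P i) F i) = \sum_(i <- r | P i) rdot y (F i).
Proof. by rewrite rdotC rdot_suml; apply: eq_bigr => i _; rewrite rdotC. Qed.

(** Both scalars end on the second argument, so that the correlation of two weighted orbit points
    carries a single weight, the conjugate of [c] times [d]. *)
Lemma rdotZ (c d : R[i]) x y :
  rdot (c *: x) (d *: y) = rdot x ((((c^* )%R * d) *: y)).
Proof.
rewrite /rdot linearZl_LR /= !linearZr_LR /= rmorphM /= conjCK.
by congr complex.Re; rewrite -[LHS]/(_ * (_ * _)) mulrA [d^* * c]mulrC.
Qed.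

Lemma rdotZr (r : R) x y : rdot x (r%:C *: y) = r * rdot x y.
Proof.
rewrite /rdot linearZr_LR /=; case: (dotp x y) => a b /=.
by rewrite !(mul0r, mulr0, oppr0, subr0).
Qed.

Lemma rdotZl (r : R) x y : rdot (r%:C *: x) y = r * rdot x y.
Proof. by rewrite rdotC rdotZr rdotC. Qed.

Lemma rnormD_sqr x y :
  rnorm (x + y) ^+ 2 = rnorm x ^+ 2 + 2 * rdot x y + rnorm y ^+ 2.
Proof.
by rewrite !sqr_rnorm !(rdotDl, rdotDr) (rdotC y x); ring.
Qed.

Lemma rnormB_sqr x y :
  rnorm (x - y) ^+ 2 = rnorm x ^+ 2 - 2 * rdot x y + rnorm y ^+ 2.
Proof.
rewrite rnormD_sqr rnormN; have -> : - y = (-1)%:C *: y.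
  by rewrite rmorphN rmorph1 scaleN1r.
by rewrite rdotZr; ring.
Qed.

Lemma parallelogram x y :
  rnorm (x + y) ^+ 2 + rnorm (x - y) ^+ 2 = 2 * rnorm x ^+ 2 + 2 * rnorm y ^+ 2.
Proof. by rewrite rnormD_sqr rnormB_sqr; ring. Qed.

Lemma cauchy_schwarz x y : `|rdot x y| <= rnorm x * rnorm y.
Proof.
have [y0|y0] := eqVneq (rnorm y) 0.
  by rewrite (rnorm0_eq0 y0) rdotC rdot0l normr0 rnorm0 mulr0.
have yp : 0 < rnorm y by rewrite lt_def y0 rnorm_ge0.
(* This vector is the component of [x] orthogonal to [y] for [rdot], scaled by the square norm of
   [y] to avoid a division. *)
have := sqr_ge0 (rnorm ((rnorm y ^+ 2)%:C *: x - (rdot x y)%:C *: y)).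
rewrite rnormB_sqr rdotZr rdotZl !rnormZ !rnormC ger0_norm ?sqr_ge0 //.
have -> : (rnorm y ^+ 2 * rnorm x) ^+ 2 - 2 * (rdot x y * (rnorm y ^+ 2 * rdot x y)) +
  (`|rdot x y| * rnorm y) ^+ 2 = rnorm y ^+ 2 * ((rnorm x * rnorm y) ^+ 2 - `|rdot x y| ^+ 2).
  by rewrite !exprMn !real_normK ?num_real //; ring.
rewrite pmulr_rge0 ?exprn_gt0 // subr_ge0 ler_sqr ?nnegrE //.
by rewrite mulr_ge0 ?rnorm_ge0.
Qed.

Lemma rnorm_sum_sqr I (r : seq I) (P : pred I) (F : I -> H) :
  rnorm (\sum_(i <- r | P i) F i) ^+ 2 =
  \sum_(i <- r | P i) \sum_(j <- r | P j) rdot (F i) (F j).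
Proof.
by rewrite sqr_rnorm rdot_suml; apply: eq_bigr => i _; rewrite rdot_sumr.
Qed.

End InnerProduct.

(** * Mean ergodic theorem for power bounded operators *)

Section Completeness.
Context {R : realType} {H : completeNormedModType R[i]}.

Lemma cauchy_rnorm_cvg (x : nat -> H) :
  (forall e : R, 0 < e -> exists N, forall m n, (N <= m)%N -> (N <= n)%N ->
     rnorm (x m - x n) <= e) ->
  exists u, forall e : R, 0 < e -> exists N, forall n, (N <= n)%N ->
     rnorm (u - x n) <= e.
Proof.
move=> xC; have xc : cvg (x @ \oo).
  apply: cauchy_cvg; apply/cauchyP => e e0.
  have er : e = (complex.Re e)%:C by rewrite RRe_real // gtr0_real.
  have er0 : 0 < complex.Re e by rewrite -ltcR -er.
  have [|N xN] := xC (complex.Re e / 2); first by rewrite divr_gt0.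
  exists (x N); exists N => // n /= Nn.
  rewrite -ball_normE /ball_ /= rnormE er ltcR.
  by apply: (le_lt_trans (xN _ _ _ _)) => //; ilra.
exists (lim (x @ \oo)) => e e0.
have eC : 0 < e%:C :> R[i] by rewrite ltcR.
have /cvgrPdist_le /(_ _ eC) [N _ xN] := xc.
by exists N => n Nn; rewrite rnorm_le; exact: xN.
Qed.

Context (dotp : {dot H for Num.conj}).
Hypothesis dotpE : forall x : H, `|x| ^+ 2 = dotp x x.

(* Elements of nearly minimal norm form a Cauchy sequence by the parallelogram
   law; this replaces weak compactness of balls. *)
Lemma nested_convex_nonempty (S : nat -> set H) (B : R) :
  (forall n, S n !=set0) ->
  (forall m n, (m <= n)%N -> S n `<=` S m) ->
  (forall n x y, S n x -> S n y -> S n ((2^-1)%:C *: (x + y))) ->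
  (forall n x, (forall e : R, 0 < e -> exists2 y, S n y & rnorm (x - y) <= e) ->
     S n x) ->
  (forall n x, S n x -> rnorm x <= B) ->
  exists x, forall n, S n x.
Proof.
move=> S0 Sdecr Sconv Sclosed SB.
pose E n := [set rnorm x ^+ 2 | x in S n].
have Elb n : has_lbound (E n) by exists 0 => _ [x _ <-]; exact: sqr_ge0.
have E0 n : E n !=set0 by have [x Sx] := S0 n; exists (rnorm x ^+ 2); exists x.
have infE n : has_inf (E n) by split.
pose d n := inf (E n).
have dle n x : S n x -> d n <= rnorm x ^+ 2.
  by move=> Sx; apply: ge_inf => //; exists x.
have dincr m n : (m <= n)%N -> d m <= d n.
  move=> mn; apply: lb_le_inf => // _ [x Sx <-].
  by apply: dle; apply: Sdecr Sx.
have dB n : d n <= B ^+ 2.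
  have [x Sx] := S0 n; apply: le_trans (dle _ _ Sx) _.
  by rewrite ler_pXn2r ?nnegrE ?rnorm_ge0 ?(le_trans (rnorm_ge0 x)) ?(SB n).
have supD : has_sup (range d).
  by split; [exists (d 0); exists 0 | exists (B ^+ 2) => _ [n _ <-]].
have xP n : exists x, S n x /\ rnorm x ^+ 2 <= d n + n.+1%:R^-1.
  have [|_ [x Sx <-] xd] := @inf_adherent _ (E n) n.+1%:R^-1 _ (infE n).
    by rewrite invr_gt0.
  by exists x; split => //; exact: ltW.
have [x xS] := choice xP.
(* The midpoint of [x m] and [x n] lies in [S m], so their sum has square norm at least [4 * d m];
   the parallelogram law leaves only [d n - d m] and the errors in the choice of [x]. *)
have dist m n : (m <= n)%N ->
    rnorm (x m - x n) ^+ 2 <= 2 * (d n - d m) + 4 * m.+1%:R^-1.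
  move=> mn.
  have := parallelogram dotpE (x m) (x n).
  have [Sm xm] := xS m; have [Sn xn] := xS n.
  have /dle := Sconv _ _ _ Sm (Sdecr _ _ mn _ Sn).
  rewrite rnormZr ?invr_ge0 // exprMn (_ : 2^-1 ^+ 2 = 4^-1 :> R); last by field.
  have : n.+1%:R^-1 <= m.+1%:R^-1 :> R by rewrite lef_pV2 ?posrE // ler_nat.
  by move: (m.+1%:R^-1) (n.+1%:R^-1) xm xn; ilra.
have [e e0|u ux] := @cauchy_rnorm_cvg x.
  (* With both quantities in [dist] below e^2/32 the bound is 6 e^2/32, less than (e/2)^2. *)
  have e2 : 0 < e ^+ 2 / 32 by rewrite divr_gt0 ?exprn_gt0.
  have [_ [N0 _ <-] N0d] := sup_adherent e2 supD.
  have [N1 N1P] := inv_nat_lt e2.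
  pose N := maxn N0 N1; exists N.
  have xN n : (N <= n)%N -> rnorm (x N - x n) <= e / 2.
    move=> Nn; rewrite -ler_sqr ?nnegrE ?rnorm_ge0 ?divr_ge0 ?(ltW e0) //.
    apply: (le_trans (dist _ _ Nn)).
    have dn : d n <= sup (range d) by apply: sup_upper_bound => //; exists n.
    have dN : d N0 <= d N by apply: dincr; exact: leq_maxl.
    have : N.+1%:R^-1 <= N1.+1%:R^-1 :> R.
      by rewrite lef_pV2 ?posrE // ler_nat ltnS leq_maxr.
    rewrite (_ : (e / 2) ^+ 2 = e ^+ 2 / 4); last by field.
    move: (N.+1%:R^-1) (N1.+1%:R^-1) N1P; ilra.
  move=> m n /xN mN /xN nN.
  rewrite (_ : x m - x n = (x N - x n) - (x N - x m)); last first.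
    by rewrite opprB [RHS]addrC addrA subrK.
  by apply: (le_trans (rnormB _ _)); ilra.
exists u => n; apply: Sclosed => e e0; have [N Nx] := ux _ e0.
exists (x (maxn N n)); last by apply: Nx; exact: leq_maxl.
by apply: Sdecr (xS _).1; exact: leq_maxr.
Qed.

End Completeness.

Section LinearIterates.
Context {C : numFieldType} {U : lmodType C} (V : {linear U -> U}).

Lemma iter_linD n u v : iter n V (u + v) = iter n V u + iter n V v.
Proof. by elim: n => //= n ->; rewrite linearD. Qed.

Lemma iter_linZ n c u : iter n V (c *: u) = c *: iter n V u.
Proof. by elim: n => //= n ->; rewrite linearZ. Qed.

Lemma iter_lin0 n : iter n V 0 = 0.
Proof. by elim: n => //= n ->; rewrite linear0. Qed.

Lemma iter_lin_sum n I (r : seq I) (P : pred I) (F : I -> U) :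
  iter n V (\sum_(i <- r | P i) F i) = \sum_(i <- r | P i) iter n V (F i).
Proof. by apply: big_morph => [u v|]; rewrite ?iter_linD ?iter_lin0. Qed.

Lemma iter_scale (c : C) n u : iter n (c \*: V) u = c ^+ n *: iter n V u.
Proof.
elim: n => [|n IH]; first by rewrite expr0 scale1r.
by rewrite iterS IH /= linearZ /= scalerA exprS.
Qed.

End LinearIterates.

Section MeanErgodic.
Context {R : realType} {H : completeNormedModType R[i]}.
Context (dotp : {dot H for Num.conj}).
Hypothesis dotpE : forall x : H, `|x| ^+ 2 = dotp x x.
Context (V : {linear H -> H}) (M : R).
Hypothesis M0 : 0 <= M.
Hypothesis VM : forall n u, rnorm (iter n V u) <= M * rnorm u.

Let S N u := \sum_(0 <= n < N) iter n V u.

Let SD N u v : S N (u + v) = S N u + S N v.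
Proof. by rewrite /S -big_split; apply: eq_bigr => i _; rewrite iter_linD. Qed.

Let SZ N c u : S N (c *: u) = c *: S N u.
Proof. by rewrite /S scaler_sumr; apply: eq_bigr => i _; rewrite iter_linZ. Qed.

Let SN N u : S N (- u) = - S N u.
Proof. by rewrite -[- u]scaleN1r SZ scaleN1r. Qed.

Let S_le N u : rnorm (S N u) <= N%:R * (M * rnorm u).
Proof.
rewrite -[X in X%:R]subn0; apply: rnorm_sum_le => [|i _ _]; last exact: VM.
exact: le_trans (rnorm_ge0 _) (VM 0 u).
Qed.

(** Telescoping leaves two boundary terms for each of the [k] unit shifts, so the bound does not
    grow with [N]. *)
Let S_shift N k u :
  rnorm (S N (iter k V u - u)) <= k%:R * (2 * M * rnorm u).
Proof.
elim: k => [|k IH]; first by rewrite subrr -(scale0r u) SZ scale0r rnorm0 mul0r.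
rewrite (_ : _ - u = (iter k.+1 V u - iter k V u) + (iter k V u - u)); last first.
  by rewrite addrA subrK.
rewrite SD; apply: (le_trans (rnormD _ _)).
suff : rnorm (S N (iter k.+1 V u - iter k V u)) <= 2 * M * rnorm u.
  by move: IH; rewrite -[in X in _ -> _ -> X]natr1 mulrDl; ilra.
have -> : S N (iter k.+1 V u - iter k V u) = iter (N + k) V u - iter k V u.
  rewrite SD SN /S -sumrB; under eq_bigr do rewrite -!iterD addnS -addSn.
  by rewrite telescope_sumr // add0n.
by apply: (le_trans (rnormB _ _)); have := VM (N + k) u; have := VM k u; ilra.
Qed.

Let C (x : H) : set H := [set u | forall e : R, 0 < e ->
  exists N0, forall N, (N0 <= N)%N -> rnorm (S N (u - x)) <= e * N%:R].

(* A fixed vector is found in the closed convex set C of all u whose Cesaro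
   means are asymptotic to those of x. *)
Lemma mean_ergodic : (forall u, V u = u -> u = 0) ->
  forall (x : H) (e : R), 0 < e -> exists N0, forall N, (N0 <= N)%N ->
    rnorm (\sum_(0 <= n < N) iter n V x) <= e * N%:R.
Proof.
move=> Vfix x; pose K := (1 + M) * rnorm x.
have Mx0 : 0 <= M * rnorm x := le_trans (rnorm_ge0 _) (VM 0 x).
have K0 : 0 <= K by rewrite /K mulrDl mul1r addr_ge0 ?rnorm_ge0.
(* A common element of all [F n] is fixed by [V], hence is 0, and the membership of 0 in [C x] is
   the claim. *)
pose F (n : nat) := [set u | [/\ C x u, rnorm u <= M * rnorm x
  & rnorm (u - V u) <= K * n.+1%:R^-1]].
have [||||n u []//|u uF] := nested_convex_nonempty dotpE (S := F) (B := M * rnorm x).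
(* The witness is the Cesaro mean of length n + 1: by telescoping, [V] moves it by (x - V^(n+1)
   x)/(n+1), of norm at most K/(n+1). *)
- move=> n; exists ((n.+1%:R^-1)%:C *: S n.+1 x); split.
  + move=> e e0; have [N0 N0P] : exists N0 : nat, n.+1%:R * (2 * M * rnorm x) <= e * N0%:R.
      have [N0 N0P] := nat_gt (n.+1%:R * (2 * M * rnorm x) / e).
      by exists N0; rewrite [e * _]mulrC -ler_pdivrMr // ltW.
    exists N0 => N NN0; apply: le_trans (_ : e * N0%:R <= _); last first.
      by rewrite ler_pM2l // ler_nat.
    apply: le_trans N0P.
    rewrite (_ : _ - x = \sum_(0 <= k < n.+1) (n.+1%:R^-1)%:C *: (iter k V x - x)); last first.
      rewrite -scaler_sumr sumrB scalerBr; congr (_ - _).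
      rewrite sumr_const_nat subn0 -[x *+ _]scaler_nat scalerA.
      by rewrite fmorphV rmorph_nat mulVf ?scale1r // pnatr_eq0.
    rewrite /S; under eq_bigr do rewrite iter_lin_sum.
    rewrite exchange_big /=.
    under eq_bigr => k _ do
      (under eq_bigr do rewrite iter_linZ; rewrite -scaler_sumr).
    rewrite -[X in X%:R * _]subn0; apply: rnorm_sum_le; first by rewrite -mulrA mulr_ge0.
    move=> k /andP[_ kn] _; rewrite rnormZr ?invr_ge0 //.
    rewrite ler_pdivrMl //; apply: le_trans (S_shift N k x) _.
    by apply: ler_wpM2r; rewrite ?ler_nat ?(ltnW kn) // -mulrA mulr_ge0.
  + rewrite rnormZr ?invr_ge0 // ler_pdivrMl //; exact: S_le.
  + rewrite linearZ /= -scalerBr rnormZr ?invr_ge0 // mulrC ler_pM2r ?invr_gt0 //.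
    rewrite /S raddf_sum -sumrB /= -[X in rnorm X]opprK -sumrN.
    under eq_bigr do rewrite opprB -iterS.
    rewrite telescope_sumr //= -iterS rnormN; apply: (le_trans (rnormB _ _)).
    by rewrite /K mulrDl mul1r addrC lerD2l VM.
- move=> m n mn u [Cu uM uV]; split => //; apply: (le_trans uV).
  by rewrite ler_wpM2l // lef_pV2 ?posrE // ler_nat.
- move=> n u v [Cu uM uV] [Cv vM vV]; split.
  + move=> e e0; have [N1 N1P] := Cu _ e0; have [N2 N2P] := Cv _ e0.
    exists (maxn N1 N2) => N; rewrite geq_max => /andP[/N1P h1 /N2P h2].
    rewrite (_ : _ - x = (2^-1)%:C *: ((u - x) + (v - x))); last first.
      rewrite addrACA -opprD scalerBr; congr (_ - _).
      rewrite -mulr2n -[x *+ _]scaler_nat scalerA fmorphV rmorph_nat mulVf ?scale1r //.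
    rewrite SZ SD rnormZr ?invr_ge0 //; have := rnormD (S N (u - x)) (S N (v - x)).
    ilra.
  + by rewrite rnormZr ?invr_ge0 //; have := rnormD u v; ilra.
  + rewrite linearZ -scalerBr rnormZr ?invr_ge0 // linearD opprD addrACA.
    by have := rnormD (u - V u) (v - V v); move: (K * _) uV vV; ilra.
(* Closedness: [S N] has norm at most N M, so an approximation of [u] within e/(2(M + 1)) costs at
   most half of e N. *)
- move=> n u ucl; split.
  + move=> e e0; have M1 : 0 < M + 1 by rewrite ltr_wpDl.
    have e1 : 0 < e / (2 * (M + 1)) by rewrite divr_gt0 // mulr_gt0.
    have [v [Cv _ _] uv] := ucl _ e1.
    have e2 : 0 < e / 2 by rewrite divr_gt0.
    have [N0 N0P] := Cv _ e2; exists N0 => N /N0P h.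
    rewrite (_ : u - x = (u - v) + (v - x)); last by rewrite addrA subrK.
    rewrite SD; apply: (le_trans (rnormD _ _)).
    suff : rnorm (S N (u - v)) <= e / 2 * N%:R by lra.
    apply: (le_trans (S_le _ _)); rewrite mulrC; apply: ler_wpM2r => //.
    apply: (@le_trans _ _ ((M + 1) * (e / (2 * (M + 1))))); last first.
      by rewrite le_eqVlt; apply/orP; left; apply/eqP; field; rewrite gt_eqF.
    by apply: ler_pM => //; rewrite ?rnorm_ge0 // lerDl.
  + apply/ler_addgt0Pr => e e0; have [v [_ vM _] uv] := ucl _ e0.
    by have := rnormD (u - v) v; rewrite subrK; ilra.
  + apply/ler_addgt0Pr => e e0.
    have e1 : 0 < e / (1 + M) by rewrite divr_gt0 // ltr_wpDr.
    have [v [_ _ vV] uv] := ucl _ e1.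
    rewrite (_ : u - V u = (v - V v) + ((u - v) - V (u - v))); last first.
      by rewrite (raddfB V) opprB (addrC (u - v)) addrA subrKA addrC subrKA.
    apply: (le_trans (rnormD _ _)); apply: lerD => //.
    apply: (le_trans (rnormB _ _)); have := VM 1 (u - v) => /= h.
    apply: (@le_trans _ _ ((1 + M) * rnorm (u - v))); first by lra.
    by rewrite -ler_pdivlMl ?ltr_wpDr // mulrC.
have u0 : u = 0.
  apply: Vfix; apply/eqP; rewrite eq_sym -subr_eq0; apply/eqP/rnorm0_eq0/eqP.
  rewrite eq_le rnorm_ge0 andbT; apply/ler_addgt0Pr => e e0; rewrite add0r.
  have [n nP] := nat_gt (K / e).
  have [_ _ /le_trans] := uF n; apply.
  by rewrite ler_pdivrMr // mulrC -ler_pdivrMr // (le_trans (ltW nP)) // ler_nat.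
have [+ _ _] := uF 0; rewrite u0 => C0 e e0; have [N0 N0P] := C0 _ e0.
by exists N0 => N /N0P; rewrite sub0r SN rnormN.
Qed.

End MeanErgodic.

(** * Exponentials and ergodic averages uniform in the rotation *)

Section Expi2pi.
Context {R : realType}.
Implicit Types s t : R.

Lemma expi2piD s t : expi2pi (s + t) = expi2pi s * expi2pi t.
Proof.
rewrite /expi2pi mulrDr cosD sinD.
by apply/eqP; rewrite eq_complex /= [X in _ && (X == _)]addrC !eqxx.
Qed.

Lemma expi2pi0 : expi2pi 0 = 1 :> R[i].
Proof. by rewrite /expi2pi mulr0 cos0 sin0. Qed.

Lemma expi2pi1 : expi2pi 1 = 1 :> R[i].
Proof. by rewrite /expi2pi mulr1 mulr_natl cos2pi sin2pi. Qed.

Lemma expi2piMn n t : expi2pi (n%:R * t) = expi2pi t ^+ n.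
Proof.
elim: n => [|n IH]; first by rewrite mul0r expi2pi0.
by rewrite -natr1 mulrDl mul1r expi2piD IH exprSr.
Qed.

Lemma rnorm_expi2pi t : rnorm (expi2pi t) = 1.
Proof. by rewrite /rnorm normc_def /= cos2Dsin2 sqrtr1. Qed.

(** The real part is 1 - 2 sin(pi t)^2, and the sine is positive on ]0, pi[. *)
Lemma expi2pi_neq1 t : 0 < t < 1 -> expi2pi t != 1.
Proof.
move=> /andP[t0 t1]; rewrite eq_complex /= negb_and; apply/orP; left.
rewrite -mulrA mulr_natl cos_mulr2n.
have : 0 < sin (pi * t).
  apply: sin_gt0_pi; rewrite mulr_gt0 ?pi_gt0 //=.
  by rewrite gtr_pMr ?pi_gt0.
move=> s0; rewrite lt_eqF // cos2sin2.
have : 0 < sin (pi * t) ^+ 2 by rewrite exprn_gt0.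
ilra.
Qed.

Lemma rnorm_Complex_le (a b : R) : rnorm (Complex a b) <= `|a| + `|b|.
Proof.
rewrite [Complex a b]complexE; apply: (le_trans (rnormD _ _)).
rewrite rnormM !rnormC /= lerD2l /rnorm normc_def /= expr0n expr1n add0r sqrtr1.
by rewrite mul1r.
Qed.

Lemma expi2pi_near t (e : R) : 0 < e ->
  \forall s \near t, rnorm (expi2pi s - expi2pi t) <= e.
Proof.
move=> e0; have e2 : 0 < e / 2 by rewrite divr_gt0.
have lin : (fun s => 2 * pi * s : R^o) @ t --> 2 * pi * t.
  by apply: cvgM; [exact: cvg_cst | exact: cvg_id].
have /cvgrPdist_le /(_ _ e2) ct : cos (2 * pi * s) @[s --> t] --> cos (2 * pi * t).
  by apply: continuous_cvg lin; exact: continuous_cos.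
have /cvgrPdist_le /(_ _ e2) st : sin (2 * pi * s) @[s --> t] --> sin (2 * pi * t).
  by apply: continuous_cvg lin; exact: continuous_sin.
near=> s.
have c : `|cos (2 * pi * t) - cos (2 * pi * s)| <= e / 2 by near: s.
have d : `|sin (2 * pi * t) - sin (2 * pi * s)| <= e / 2 by near: s.
rewrite rdistC; apply: (le_trans (rnorm_Complex_le _ _)).
move: c d; ilra.
Unshelve. all: by end_near. Qed.

Lemma rnorm_subX (c d : R[i]) n : rnorm c = 1 -> rnorm d = 1 ->
  rnorm (c ^+ n - d ^+ n) <= n%:R * rnorm (c - d).
Proof.
move=> c1 d1; elim: n => [|n IH]; first by rewrite subrr rnorm0 mul0r.
rewrite (_ : _ - _ = c * (c ^+ n - d ^+ n) + (c - d) * d ^+ n); last first.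
  by rewrite !exprS; ring.
apply: (le_trans (rnormD _ _)).
by rewrite !rnormM c1 (rnormX _ d1) mul1r mulr1 -natr1 mulrDl mul1r lerD2r.
Qed.

End Expi2pi.

Section UniformRotation.
Context {R : realType} {H : completeNormedModType R[i]}.

(** The last block of length [N0] is V^(N - N0) of the initial one, so smallness at the single
    length [N0] propagates to every [N] at the cost of a factor [M]. A condition on one length,
    unlike one on all large lengths, visibly survives a small change of the rotation. *)
Lemma block_averages (V : {linear H -> H}) (M : R) (x : H) (e : R) N0 :
  0 <= M -> (forall n u, rnorm (iter n V u) <= M * rnorm u) ->
  (0 < N0)%N -> 0 <= e ->
  rnorm (\sum_(0 <= n < N0) iter n V x) <= e * N0%:R ->
  forall N, rnorm (\sum_(0 <= n < N) iter n V x)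
            <= M * e * N%:R + N0%:R * (M * rnorm x).
Proof.
move=> M0 VM N00 e0 h; elim/ltn_ind => N IH.
have [NN0|N0N] := ltnP N N0.
  apply: (@le_trans _ _ (N%:R * (M * rnorm x))).
    by rewrite -[X in X%:R * _]subn0; apply: rnorm_sum_le => [|i _ _];
      rewrite ?mulr_ge0 ?rnorm_ge0.
  rewrite -[leLHS]add0r lerD ?mulr_ge0 // ler_wpM2r ?mulr_ge0 ?rnorm_ge0 //.
  by rewrite ler_nat ltnW.
rewrite (big_cat_nat _ (n := N - N0)) ?leq_subr //=.
have -> : \sum_(N - N0 <= n < N) iter n V x =
    iter (N - N0) V (\sum_(0 <= n < N0) iter n V x).
  rewrite iter_lin_sum -[X in \sum_(X <= _ < _) _]add0n big_addn subKn //.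
  by apply: eq_bigr => i _; rewrite addnC iterD.
apply: (le_trans (rnormD _ _)); apply: (le_trans (lerD (IH _ _) (VM _ _))).
  by rewrite ltn_subrL N00 (leq_trans N00).
have := ler_wpM2l M0 h; rewrite natrB //; ilra.
Qed.

Context (dotp : {dot H for Num.conj}).
Hypothesis dotpE : forall x : H, `|x| ^+ 2 = dotp x x.
Context (T : {linear H -> H}) (M : R).
Hypothesis M0 : 0 <= M.
Hypothesis TM : forall n u, rnorm (iter n T u) <= M * rnorm u.
Hypothesis T_spec : forall (c : R[i]) u, rnorm c = 1 -> c *: T u = u -> u = 0.

Lemma rotated_power_le (c : R[i]) n u : rnorm c = 1 ->
  rnorm (iter n (c \*: T) u) <= M * rnorm u.
Proof. by move=> c1; rewrite iter_scale rnormZ rnormX // mul1r. Qed.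

Lemma mean_ergodic_uniform (x : H) (e : R) : 0 < e ->
  exists N0, forall N, (N0 <= N)%N -> forall t, 0 <= t <= 1 ->
    rnorm (\sum_(0 <= n < N) expi2pi t ^+ n *: iter n T x) <= e * N%:R.
Proof.
move=> e0; have /compact_near_coveringP := @segment_compact R 0 1.
move=> /(_ nat \oo (fun N t =>
  rnorm (\sum_(0 <= n < N) expi2pi t ^+ n *: iter n T x) <= e * N%:R)) cov.
have {cov} [] := cov _; last first.
  by move=> N0 _ N0P; exists N0 => N NN t t01; apply: N0P => //=; rewrite in_itv.
(* The perturbation of [t] doubles [e1] and [block_averages] multiplies it by [M]; this uses half of
   [e], and the other half absorbs the constant term for large [N]. *)
move=> t _; pose e1 := e / (4 * (M + 1)).
have M1 : 0 < M + 1 by rewrite ltr_wpDl.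
have e10 : 0 < e1 by rewrite divr_gt0 // mulr_gt0.
have Me1 : M * (2 * e1) <= e / 2.
  rewrite (_ : e / 2 = (M + 1) * (2 * e1)); last by rewrite /e1; field; rewrite gt_eqF.
  by apply: ler_wpM2r; [rewrite mulr_ge0 // ltW | rewrite lerDl].
have [N1 N1P] := mean_ergodic dotpE M0
  (fun n u => rotated_power_le n u (rnorm_expi2pi t))
  (fun u => T_spec (rnorm_expi2pi t)) x e10.
have {N1P} := N1P N1.+1 (leqnSn _).
under eq_bigr do rewrite iter_scale.
move: N1.+1 (ltn0Sn N1) => {N1} N1 N10 N1P.
(* For n < [N1] the n-th powers of two rotations at distance [d] differ by at most N1 d, so that
   each term of the sum of length [N1] changes by at most [e1]. *)
pose d := e1 / (N1%:R * (M * rnorm x) + 1).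
have D0 : 0 < N1%:R * (M * rnorm x) + 1 by rewrite ltr_wpDl ?mulr_ge0 ?rnorm_ge0.
have d0 : 0 < d by rewrite divr_gt0.
have [N2 N2P] := nat_gt (N1%:R * (M * rnorm x) / (e / 2)).
exists ([set s | rnorm (expi2pi s - expi2pi t) <= d], [set N | (N2 <= N)%N]).
  by split => /=; [exact: expi2pi_near | exists N2].
move=> [s N] /= [sd NN2].
under eq_bigr do rewrite -iter_scale.
have h : rnorm (\sum_(0 <= n < N1) iter n (expi2pi s \*: T) x) <= 2 * e1 * N1%:R.
  rewrite (_ : \sum_(0 <= n < N1) _ =
    \sum_(0 <= n < N1) expi2pi t ^+ n *: iter n T x +
    \sum_(0 <= n < N1) (expi2pi s ^+ n - expi2pi t ^+ n) *: iter n T x); last first.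
    rewrite -big_split; apply: eq_bigr => n _ /=.
    by rewrite iter_scale -scalerDl addrC subrK.
  apply: (le_trans (rnormD _ _)).
  suff : rnorm (\sum_(0 <= n < N1) (expi2pi s ^+ n - expi2pi t ^+ n) *: iter n T x)
     <= N1%:R * e1 by ilra.
  rewrite -{2}[N1]subn0; apply: rnorm_sum_le => [|n /andP[_ nN1] _]; first exact: ltW.
  rewrite rnormZ; apply: (@le_trans _ _ (N1%:R * d * (M * rnorm x))).
    apply: ler_pM; rewrite ?rnorm_ge0 ?TM //.
    apply: (le_trans (rnorm_subX _ _ _)); rewrite ?rnorm_expi2pi //.
    by apply: ler_pM; rewrite ?rnorm_ge0 // ler_nat ltnW.
  by rewrite mulrAC /d [_ * (e1 / _)]mulrA ler_pdivrMr // mulrC ler_pM2l // lerDl.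
apply: (le_trans (block_averages M0
  (fun n u => rotated_power_le n u (rnorm_expi2pi s)) N10 _ h N)).
  by rewrite mulr_ge0 // ltW.
have N3 : N1%:R * (M * rnorm x) <= e / 2 * N%:R.
  rewrite [leRHS]mulrC -ler_pdivrMr ?divr_gt0 //.
  by apply: le_trans (ltW N2P) _; rewrite ler_nat.
have := ler_wpM2r (ler0n R N) Me1; move: N3; ilra.
Qed.

End UniformRotation.

(** * Discrete Fourier analysis of periodic sequences of vectors *)

Section FourierOrthogonality.
Context {R : realType}.

Lemma expi2piN (t : R) : expi2pi (- t) = ((expi2pi t)^* )%R.
Proof. by rewrite /expi2pi mulrN cosN sinN. Qed.

Lemma expi2pi_nat n : expi2pi (n%:R : R) = 1.
Proof. by rewrite -[n%:R]mulr1 expi2piMn expi2pi1 expr1n. Qed.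

Lemma expi2pi_neq1_abs (t : R) : t != 0 -> -1 < t < 1 -> expi2pi t != 1.
Proof.
move=> t0 /andP[tN1 t1]; case: (ltP 0 t) => [tp|tn].
  by apply: expi2pi_neq1; rewrite tp.
rewrite -[expi2pi t]mulr1 -(expi2pi1 (R := R)) -expi2piD expi2pi1.
have tlt : t < 0 by rewrite lt_neqAle t0.
by apply: expi2pi_neq1; apply/andP; split; move: tN1 tlt; ilra.
Qed.

Lemma mul_expi2pi_conj (t : R) : expi2pi t * ((expi2pi t)^* )%R = 1.
Proof. by rewrite -expi2piN -expi2piD subrr expi2pi0. Qed.

Definition root_of_unity (P r : nat) : R[i] := expi2pi (r%:R / P%:R).

(** For i != j the sum is geometric, with a ratio whose P-th power is 1; the ratio itself is not 1
    because |j - i| < P. *)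
Lemma sum_roots_of_unity P i j : (i < P)%N -> (j < P)%N ->
  \sum_(0 <= r < P) ((root_of_unity P r)^* )%R ^+ i * root_of_unity P r ^+ j
    = (P%:R *+ (i == j)) :> R[i].
Proof.
move=> iP jP; have P0 : (0 < P)%N by apply: leq_ltn_trans iP.
have PR0 : P%:R != 0 :> R by rewrite pnatr_eq0 -lt0n.
case: eqVneq => [->|ij].
  under eq_bigr do rewrite -exprMn mulrC mul_expi2pi_conj expr1n.
  by rewrite sumr_const_nat subn0 mulr1n.
pose z : R[i] := expi2pi ((j%:R - i%:R) / P%:R).
have zE r : ((root_of_unity P r)^* )%R ^+ i * root_of_unity P r ^+ j = z ^+ r.
  rewrite -expi2piN -!expi2piMn -expi2piD; congr expi2pi.
  by field.
under eq_bigr do rewrite zE.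
have z1 : z - 1 != 0.
  rewrite subr_eq0; apply: expi2pi_neq1_abs.
    by rewrite mulf_neq0 ?invr_eq0 // subr_eq0 eqr_nat eq_sym.
  have PR : 0 < P%:R :> R by rewrite ltr0n.
  have hi : i%:R + 1 <= P%:R :> R by rewrite natr1 ler_nat.
  have hj : j%:R + 1 <= P%:R :> R by rewrite natr1 ler_nat.
  have hi0 : 0 <= i%:R :> R by [].
  have hj0 : 0 <= j%:R :> R by [].
  by rewrite ltr_pdivlMr // ltr_pdivrMr //; apply/andP; split; lra.
apply: (mulfI z1); rewrite mulr0n mulr0 big_mkord -subrX1.
rewrite -expi2piMn mulrC divfK // expi2piD expi2piN !expi2pi_nat rmorph1 mulr1.
by rewrite subrr.
Qed.

End FourierOrthogonality.

Lemma sum_periodic (V : nmodType) (P : nat) (G : nat -> V) n :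
  (forall i, G (i + P)%N = G i) ->
  \sum_(0 <= i < P) G (n + i)%N = \sum_(0 <= i < P) G i.
Proof.
move=> GP; elim: n => [//|n <-].
case: P GP => [|P] GP; first by rewrite !big_geq.
rewrite big_nat_recr //= [RHS]big_nat_recl //= addrC addn0 addSnnS GP.
by congr (_ + _); apply: eq_bigr => i _; rewrite addSnnS.
Qed.

Section PeriodicSequences.
Context {R : realType} {H : normedModType R[i]}.
Context (dotp : {dot H for Num.conj}).
Hypothesis dotpE : forall x : H, `|x| ^+ 2 = dotp x x.
Context (P : nat) (y : nat -> H).
Hypothesis yP : forall i, y (i + P)%N = y i.
Local Notation zeta := (@root_of_unity R P).

Lemma dotp_sum2 I J (r : seq I) (s : seq J) (F : I -> H) (G : J -> H) :
  dotp (\sum_(i <- r) F i) (\sum_(j <- s) G j) =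
  \sum_(i <- r) \sum_(j <- s) dotp (F i) (G j).
Proof.
transitivity (\sum_(i <- r) dotp (F i) (\sum_(j <- s) G j)).
  apply: (big_morph (fun u => dotp u _)) => [u v|]; first exact: linearDl.
  exact: linear0l.
apply: eq_bigr => i _; apply: (big_morph (dotp (F i))) => [u v|].
  exact: linearD.
exact: linear0.
Qed.

Lemma dotpZ2 (c d : R[i]) u v :
  dotp (c *: u) (d *: v) = c * (d^* )%R * dotp u v.
Proof. by rewrite linearZl_LR /= linearZr_LR /= -[LHS]/(_ * (_ * _)) mulrA. Qed.

(** Cyclic autocorrelation over one period, not divided by [P]; [Z] is the equally unnormalised
    discrete Fourier transform. *)
Let B n m : R[i] := \sum_(0 <= i < P) dotp (y (n + i)%N) (y (m + i)%N).
Let Z r : H := \sum_(0 <= i < P) ((zeta r)^* )%R ^+ i *: y i.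

Lemma fourier_coef_shift r n : zeta r ^+ n *: Z r =
  \sum_(0 <= i < P) ((zeta r)^* )%R ^+ i *: y (n + i)%N.
Proof.
have [P0|P0] := posnP P; first by rewrite /Z P0 !big_geq ?scaler0.
have zP : zeta r ^+ P = 1.
  by rewrite /root_of_unity -expi2piMn mulrC divfK ?pnatr_eq0 -?lt0n // expi2pi_nat.
rewrite /Z -(sum_periodic (G := fun i => ((zeta r)^* )%R ^+ i *: y i) n); last first.
  by move=> i; rewrite yP exprD -[_ ^+ P]rmorphXn /= zP rmorph1 mulr1.
rewrite scaler_sumr; apply: eq_bigr => i _.
by rewrite scalerA exprD mulrA -exprMn mul_expi2pi_conj expr1n mul1r.
Qed.

(** Parseval's identity for the translates by [n] and [m], whose coefficients are those of [y] times
    powers of [zeta r]. It is a finite Herglotz theorem: the autocorrelation is the Fourier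
    transform of the positive masses [|Z r|^2]. *)
Lemma autocorrelation_fourier n m :
  P%:R * B n m = \sum_(0 <= r < P) `|Z r| ^+ 2 * zeta r ^+ n * ((zeta r)^* )%R ^+ m.
Proof.
under eq_bigr => r _ do
  rewrite dotpE -mulrA mulrC -[_ ^+ m]rmorphXn -dotpZ2 !fourier_coef_shift dotp_sum2.
rewrite exchange_big /B mulr_sumr; apply: eq_big_nat => i /andP[_ iP] /=.
rewrite exchange_big /=.
under eq_big_nat => j jP.
  under eq_bigr => r _ do rewrite dotpZ2 rmorphXn /= conjCK.
  rewrite -mulr_suml sum_roots_of_unity //; over.
rewrite (big_cat_nat _ (n := i)) ?(ltnW iP) //= [X in _ = _ + X]big_ltn // eqxx mulr1n.
rewrite big_nat big1 => [|j /andP[_ ji]]; last by rewrite gtn_eqF // mulr0n mul0r.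
rewrite add0r big_nat big1 ?addr0 // => j /andP[ij _].
by rewrite ltn_eqF // mulr0n mul0r.
Qed.

Lemma sum_norm_sqr_autocorrelation N (c : nat -> R[i]) :
  \sum_(0 <= i < P) `|\sum_(0 <= n < N) c n *: y (n + i)%N| ^+ 2 =
  \sum_(0 <= n < N) \sum_(0 <= m < N) c n * ((c m)^* )%R * B n m.
Proof.
under eq_bigr do rewrite dotpE dotp_sum2.
rewrite exchange_big; apply: eq_bigr => n _ /=.
rewrite exchange_big; apply: eq_bigr => m _ /=.
by rewrite /B mulr_sumr; apply: eq_bigr => i _; rewrite dotpZ2.
Qed.

(** One factor of each |B n m|^2 is expanded by [autocorrelation_fourier]. For fixed [r] the sum
    over n and m is then the square mean of a rotated sum, at most P d by hypothesis, while the
    total mass of [|Z r|^2] is P B 0 0, at most P^2 X^2. *)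
Lemma sum_autocorrelation_sqr_le N (X d : R) :
  (forall i, rnorm (y i) <= X) ->
  (forall t, 0 <= t <= 1 ->
    \sum_(0 <= i < P) rnorm (\sum_(0 <= n < N) expi2pi t ^+ n *: y (n + i)%N) ^+ 2
      <= P%:R * d) ->
  \sum_(0 <= n < N) \sum_(0 <= m < N) rnorm (B n m) ^+ 2 <= P%:R ^+ 2 * X ^+ 2 * d.
Proof.
move=> yX h; have [P0|P0] := posnP P.
  rewrite P0 expr0n mul0r mul0r big1 // => n _; rewrite big1 // => m _.
  by rewrite /B P0 big_geq // rnorm0 expr0n.
have PC : 0 < P%:R :> R[i] by rewrite ltr0n.
have d0 : 0 <= d.
  rewrite -(pmulr_rge0 _ (_ : 0 < P%:R)) ?ltr0n //.
  by apply: le_trans (h 0 _); rewrite ?lexx ?ler01 // sumr_ge0 // => i _; exact: sqr_ge0.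
have Zsum : \sum_(0 <= r < P) `|Z r| ^+ 2 <= (P%:R ^+ 2 * X ^+ 2)%:C.
  have := autocorrelation_fourier 0 0.
  under eq_bigr do rewrite !expr0 !mulr1.
  move=> <-; rewrite rmorphM /= rmorphXn /= rmorph_nat expr2 -mulrA ler_pM2l //.
  rewrite /B; under eq_bigr do rewrite add0n -dotpE rnormE -rmorphXn.
  rewrite -rmorph_sum /= -(rmorph_nat (real_complex R)) -rmorphM /= lecR.
  rewrite mulr_natl -[X in _ *+ X]subn0 -sumr_const_nat; apply: ler_sum => i _.
  by rewrite ler_pXn2r ?nnegrE ?rnorm_ge0 ?(le_trans (rnorm_ge0 _) (yX i)).
rewrite -lecR -(ler_pM2l PC).
have -> : P%:R * (\sum_(0 <= n < N) \sum_(0 <= m < N) rnorm (B n m) ^+ 2)%:C =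
   \sum_(0 <= r < P) `|Z r| ^+ 2 * \sum_(0 <= n < N) \sum_(0 <= m < N)
        ((zeta r)^* )%R ^+ n * ((((zeta r)^* )%R ^+ m)^* )%R * B n m.
  under [RHS]eq_bigr do rewrite mulr_sumr.
  rewrite [RHS]exchange_big rmorph_sum mulr_sumr; apply: eq_bigr => n _ /=.
  under [RHS]eq_bigr do rewrite mulr_sumr.
  rewrite [RHS]exchange_big rmorph_sum mulr_sumr; apply: eq_bigr => m _ /=.
  rewrite rmorphXn /= -rnormE normCK mulrCA.
  have -> : P%:R * ((B n m)^* )%R = ((P%:R * B n m)^* )%R by rewrite rmorphM /= conjC_nat.
  rewrite autocorrelation_fourier rmorph_sum mulr_sumr; apply: eq_bigr => r _ /=.
  rewrite !rmorphM /= !rmorphXn /= conjCK.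
  rewrite (CrealP (normr_real _)); ring.
under eq_bigr do rewrite -sum_norm_sqr_autocorrelation.
apply: (@le_trans _ _ (\sum_(0 <= r < P) `|Z r| ^+ 2 * (P%:R * d)%:C)).
  rewrite !big_nat; apply: ler_sum => r /andP[_ rP]; apply: ler_wpM2l.
    by rewrite exprn_ge0.
  under eq_bigr do rewrite rnormE -rmorphXn.
  rewrite -rmorph_sum lecR.
  (* Adding 1 brings the negative frequency into [0, 1], where the hypothesis is stated. *)
  have -> : ((zeta r)^* )%R = expi2pi (1 - r%:R / P%:R).
    by rewrite expi2piD expi2pi1 mul1r expi2piN.
  apply: h; rewrite subr_ge0 lerBlDr lerDl divr_ge0 // andbT.
  by rewrite ler_pdivrMr ?ltr0n // mul1r ler_nat ltnW.
rewrite -mulr_suml; apply: (@le_trans _ _ ((P%:R ^+ 2 * X ^+ 2)%:C * (P%:R * d)%:C)).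
  by apply: ler_wpM2r => //; rewrite ler0c mulr_ge0.
rewrite -rmorphM -(rmorph_nat (real_complex R)) -rmorphM lecR.
by rewrite le_eqVlt; apply/orP; left; apply/eqP; ring.
Qed.

(** Rotations alone control arbitrary weights: once the square is expanded, weights of modulus at
    most 1 disappear in absolute value, and the sum of |B n m| is reduced to that of the squares,
    with [eta] free to balance the two resulting terms. *)
Lemma weighted_sum_sqr_le N (X d eta : R) (c : nat -> R[i]) :
  (forall i, rnorm (y i) <= X) ->
  (forall t, 0 <= t <= 1 ->
    \sum_(0 <= i < P) rnorm (\sum_(0 <= n < N) expi2pi t ^+ n *: y (n + i)%N) ^+ 2
      <= P%:R * d) ->
  0 < eta -> (forall n, rnorm (c n) <= 1) ->
  \sum_(0 <= i < P) rnorm (\sum_(0 <= n < N) c n *: y (n + i)%N) ^+ 2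
    <= P%:R * (N%:R ^+ 2 * eta / 2 + X ^+ 2 * d / (2 * eta)).
Proof.
move=> yX h eta0 c1; have := sum_autocorrelation_sqr_le yX h => hB.
have [P0|P0] := posnP P; first by rewrite P0 mul0r big_geq.
have PR : 0 < P%:R :> R by rewrite ltr0n.
apply: (@le_trans _ _ (\sum_(0 <= n < N) \sum_(0 <= m < N) rnorm (B n m))).
  rewrite -lecR rmorph_sum /=.
  under eq_bigr do rewrite rmorphXn /= -rnormE.
  rewrite sum_norm_sqr_autocorrelation.
  apply: le_trans (real_ler_norm _) _.
    rewrite -sum_norm_sqr_autocorrelation; apply: ger0_real; apply: sumr_ge0 => i _.
    by rewrite exprn_ge0.
  rewrite rnormE lecR; apply: le_trans (rnorm_sum _ _ _) _; apply: ler_sum => n _.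
  apply: le_trans (rnorm_sum _ _ _) _; apply: ler_sum => m _.
  rewrite !rnormM rnorm_conj -[leRHS]mul1r ler_wpM2r ?rnorm_ge0 //.
  by rewrite mulr_ile1 ?rnorm_ge0.
(* Young's inequality *)
have young n m : rnorm (B n m) <=
    P%:R * eta / 2 + (rnorm (B n m)) ^+ 2 / (2 * P%:R * eta).
  move: (rnorm _) => b; rewrite -subr_ge0.
  have -> : P%:R * eta / 2 + b ^+ 2 / (2 * P%:R * eta) - b =
    (P%:R * eta - b) ^+ 2 / (2 * P%:R * eta).
    by field; rewrite !gt_eqF.
  by rewrite divr_ge0 ?sqr_ge0 // !mulr_ge0 // ltW.
apply: le_trans.
  by apply: ler_sum => n _; apply: ler_sum => m _; exact: young.
under eq_bigr do rewrite big_split /= sumr_const_nat subn0 -mulr_suml.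
rewrite big_split /= sumr_const_nat subn0 -mulr_suml.
have := @ler_wpM2r _ ((2 * P%:R * eta)^-1) _ _ _ hB.
rewrite invr_ge0 !mulr_ge0 ?(ltW eta0) // => /(_ isT) h1.
apply: le_trans (lerD (lexx _) h1) _.
rewrite -[X in X + _ <= _]mulr_natr -[X in X * _ + _ <= _]mulr_natr.
rewrite le_eqVlt; apply/orP; left; apply/eqP.
by field; rewrite !gt_eqF.
Qed.

End PeriodicSequences.

(** * Null exponent sequences; the case of the identity *)

Section WeightedNull.
Context {R : realType} {H : normedModType R[i]}.

(** The threshold comes before the weights, so that weights may depend on [N]: they are later
    restricted to subsets, translated, and summed over groups of equal exponents. *)
Definition weighted_null (T : H -> H) (x : H) (a : nat -> nat) : Prop :=
  forall e : R, 0 < e -> exists N0, forall N, (N0 <= N)%N ->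
  forall c : nat -> R[i], (forall n, rnorm (c n) <= 1) ->
  rnorm (\sum_(0 <= n < N) c n *: iter (a n) T x) <= e * N%:R.

End WeightedNull.

Lemma small_factor {R : realType} (K e : R) : 0 <= K -> 0 < e ->
  exists2 d, 0 < d & K * d <= e.
Proof.
move=> K0 e0; have K1 : 0 < K + 1 by rewrite ltr_wpDl.
exists (e / (K + 1)); first by rewrite divr_gt0.
by rewrite mulrA ler_pdivrMr // mulrC ler_pM2l // lerDl.
Qed.

Section BaseCase.
Context {R : realType} {H : completeNormedModType R[i]}.
Context (dotp : {dot H for Num.conj}).
Hypothesis dotpE : forall x : H, `|x| ^+ 2 = dotp x x.
Context (T : {linear H -> H}) (M : R).
Hypothesis M0 : 0 <= M.
Hypothesis TM : forall n u, rnorm (iter n T u) <= M * rnorm u.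
Hypothesis T_spec : forall (c : R[i]) u, rnorm c = 1 -> c *: T u = u -> u = 0.
Variable x : H.
Let X := M * rnorm x.

Let X0 : 0 <= X. Proof. by rewrite mulr_ge0 ?rnorm_ge0. Qed.

(** A window starting at i < P - N does not meet the end of the period and is T^i of the initial
    block; the remaining [N] windows are bounded trivially, which produces the term N/P X^2. *)
Let periodic_block_le (N P : nat) (e : R) : (0 < N <= P)%N -> 0 <= e ->
  (forall t, 0 <= t <= 1 ->
    rnorm (\sum_(0 <= n < N) expi2pi t ^+ n *: iter n T x) <= e * N%:R) ->
  forall t, 0 <= t <= 1 ->
  \sum_(0 <= i < P) rnorm (\sum_(0 <= n < N)
      expi2pi t ^+ n *: iter ((n + i) %% P) T x) ^+ 2
    <= P%:R * (N%:R ^+ 2 * (M ^+ 2 * e ^+ 2 + N%:R / P%:R * X ^+ 2)).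
Proof.
move=> /andP[N0 NP] e0 h t t01.
have P0 : 0 < P%:R :> R by rewrite ltr0n (leq_trans N0).
rewrite (big_cat_nat _ (n := P - N)) ?leq_subr //=.
apply: (@le_trans _ _ (P%:R * (M * (e * N%:R)) ^+ 2 + N%:R * (N%:R * X) ^+ 2)); last first.
  by rewrite le_eqVlt; apply/orP; left; apply/eqP; field; rewrite gt_eqF.
apply: lerD.
  apply: (@le_trans _ _ (\sum_(0 <= i < P - N) (M * (e * N%:R)) ^+ 2)).
    rewrite !big_nat; apply: ler_sum => i /andP[_ iPN].
    rewrite ler_pXn2r ?nnegrE ?rnorm_ge0 ?mulr_ge0 //.
    rewrite (_ : \sum_(0 <= n < N) _ =
       iter i T (\sum_(0 <= n < N) expi2pi t ^+ n *: iter n T x)).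
      by apply: (le_trans (TM _ _)); rewrite ler_wpM2l ?h.
    rewrite iter_lin_sum; apply: eq_big_nat => n /andP[_ nN].
    rewrite iter_linZ -iterD addnC modn_small //.
    by move: iPN nN; lia.
  rewrite sumr_const_nat subn0 -[leLHS]mulr_natl.
  by apply: ler_wpM2r; rewrite ?sqr_ge0 // ler_nat leq_subr.
apply: (@le_trans _ _ (\sum_(P - N <= i < P) (N%:R * X) ^+ 2)); last first.
  by rewrite sumr_const_nat subKn // -[leLHS]mulr_natl.
apply: ler_sum => i _; rewrite ler_pXn2r ?nnegrE ?rnorm_ge0 ?(mulr_ge0 _ X0) //.
rewrite -{2}[N]subn0; apply: rnorm_sum_le => // n _ _.
by rewrite rnormZ rnormX ?rnorm_expi2pi // mul1r TM.
Qed.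

(* A block of orbit points far enough along is T^i of a translated block for
   all i < P - N, so its square norm is dominated by the mean over i. *)
Let far_block_small (e : R) : 0 < e -> exists N P : nat, (0 < N)%N /\
  forall j (c : nat -> R[i]), (P <= j)%N -> (forall n, rnorm (c n) <= 1) ->
  rnorm (\sum_(0 <= n < N) c n *: iter (n + j) T x) <= e * N%:R.
Proof.
(* Order of choice: [eta] makes the first term of [weighted_sum_sqr_le] small, [tau] bounds what its
   second term may contain given [eta], and [d] and then [P] each receive half of [tau]. *)
move=> e0; have e2 : 0 < e ^+ 2 / 2 by rewrite divr_gt0 ?exprn_gt0.
have [eta eta0 etaP] := small_factor (sqr_ge0 M) e2.
have [|tau tau0 tauP] := @small_factor _ (M ^+ 2 * X ^+ 2 / eta) _ _ e2.
  by apply: divr_ge0 (ltW eta0); rewrite mulr_ge0 ?sqr_ge0.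
have t2 : 0 < tau / 2 by rewrite divr_gt0.
have [d0 d00 d0P] := small_factor (sqr_ge0 M) t2.
pose d := Num.min d0 1.
have dp : 0 < d by rewrite lt_min d00 ltr01.
have dP : M ^+ 2 * d ^+ 2 <= tau / 2.
  apply: le_trans d0P; apply: ler_wpM2l; first exact: sqr_ge0.
  apply: (@le_trans _ _ (d * 1)); last by rewrite mulr1 ge_min lexx.
  by rewrite expr2 ler_pM2l // ge_min lexx orbT.
have [N0 N0P] := mean_ergodic_uniform dotpE M0 TM T_spec x dp.
have {N0P} := N0P N0.+1 (leqnSn _); move: N0.+1 (ltn0Sn N0) => {}N0 N00 hN.
have [P0 P0P] := nat_gt (N0%:R * X ^+ 2 / (tau / 2)).
(* P >= 2 N0 leaves at least P/2 translates i < P - N0 for the mean. *)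
pose P := maxn P0 (2 * N0).
exists N0, P; split => // j c Pj c1.
have N0P : (N0 <= P)%N by rewrite (leq_trans _ (leq_maxr _ _)) // leq_pmull.
have PR : 0 < P%:R :> R by rewrite ltr0n (leq_trans N00).
have NPX : N0%:R / P%:R * X ^+ 2 <= tau / 2.
  rewrite mulrAC ler_pdivrMr // [leRHS]mulrC -ler_pdivrMr //.
  by rewrite (le_trans (ltW P0P)) // ler_nat leq_maxl.
have NP : (0 < N0 <= P)%N by rewrite N00.
have per i : iter ((i + P) %% P) T x = iter (i %% P) T x by rewrite modnDr.
have := weighted_sum_sqr_le dotpE per (X := X) (fun i => TM _ _)
   (periodic_block_le NP (ltW dp) hN) eta0 c1.
set S := \sum_(0 <= n < N0) _ => hS.
have lowS : (P - N0)%:R * rnorm S ^+ 2 <= M ^+ 2 * (P%:R * (N0%:R ^+ 2 * eta / 2 +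
     X ^+ 2 * (N0%:R ^+ 2 * (M ^+ 2 * d ^+ 2 + N0%:R / P%:R * X ^+ 2)) / (2 * eta))).
  apply: le_trans (ler_wpM2l (sqr_ge0 M) hS).
  rewrite mulr_sumr (big_cat_nat _ (n := P - N0)) ?leq_subr //=.
  rewrite -[leLHS]addr0; apply: lerD; last first.
    by apply: sumr_ge0 => i _; rewrite mulr_ge0 ?sqr_ge0.
  rewrite mulr_natl -[X in _ *+ X]subn0 -sumr_const_nat !big_nat.
  apply: ler_sum => i /andP[_ iPN]; rewrite -exprMn.
  rewrite ler_pXn2r ?nnegrE ?mulr_ge0 ?rnorm_ge0 //.
  rewrite (_ : S = iter (j - i) T
     (\sum_(0 <= n < N0) c n *: iter ((n + i) %% P) T x)) ?TM //.
  rewrite iter_lin_sum; apply: eq_big_nat => n /andP[_ nN].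
  rewrite iter_linZ -iterD modn_small; last first.
    by rewrite ltn_subRL in iPN; apply: leq_ltn_trans iPN; rewrite leq_add2r ltnW.
  congr (_ *: iter _ T x); rewrite addnCA subnK // (leq_trans _ Pj) //.
  by rewrite (leq_trans (ltnW iPN)) // leq_subr.
have P2 : P%:R / 2 <= (P - N0)%:R :> R.
  rewrite natrB // lerBrDl -lerBrDr.
  have : (2 * N0)%:R <= P%:R :> R by rewrite ler_nat leq_maxr.
  rewrite natrM; ilra.
rewrite -ler_sqr ?nnegrE ?rnorm_ge0 ?mulr_ge0 ?(ltW e0) //.
have S2 := ler_wpM2r (sqr_ge0 (rnorm S)) P2.
have {lowS}{}S2 := le_trans S2 lowS.
have : rnorm S ^+ 2 <= N0%:R ^+ 2 * (M ^+ 2 * eta +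
    (M ^+ 2 * X ^+ 2 / eta) * (M ^+ 2 * d ^+ 2 + N0%:R / P%:R * X ^+ 2)).
  rewrite -(ler_pM2l (_ : 0 < P%:R / 2)) ?divr_gt0 //.
  apply: le_trans S2 _; rewrite le_eqVlt; apply/orP; left; apply/eqP.
  by field; rewrite !gt_eqF.
move/le_trans; apply; rewrite [leRHS]exprMn [leLHS]mulrC; apply: ler_wpM2r => //.
have K0 : 0 <= M ^+ 2 * X ^+ 2 / eta.
  by apply: divr_ge0 (ltW eta0); rewrite mulr_ge0 ?sqr_ge0.
have := ler_wpM2l K0 (lerD dP NPX).
rewrite (_ : tau / 2 + tau / 2 = tau); last by field.
by move=> h1; have := lerD etaP (le_trans h1 tauP); ilra.
Qed.

Theorem weighted_null_id : weighted_null T x id.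
Proof.
move=> e e0; have e2 : 0 < e / 2 by rewrite divr_gt0.
have [N [P [N0 NP]]] := far_block_small e2.
(* Blocks of length [N] are removed from the right; what is left, of length below [N], costs at most
   N X. *)
have tail K (c : nat -> R[i]) : (forall n, rnorm (c n) <= 1) ->
    rnorm (\sum_(P <= n < P + K) c n *: iter n T x) <= e / 2 * K%:R + N%:R * X.
  move=> c1; elim/ltn_ind: K => K IH.
  have [KN|NK] := ltnP K N.
    rewrite -[leLHS]add0r lerD ?mulr_ge0 ?(ltW e0) //.
    apply: (@le_trans _ _ ((P + K - P)%:R * X)).
      apply: rnorm_sum_le => // n _ _; rewrite rnormZ -[X]mul1r.
      by rewrite ler_pM ?rnorm_ge0.
    by rewrite addKn ler_wpM2r // ler_nat ltnW.
  have -> : \sum_(P <= n < P + K) c n *: iter n T x =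
    \sum_(P <= n < P + (K - N)) c n *: iter n T x +
    \sum_(0 <= n < N) c (n + (P + (K - N)))%N *: iter (n + (P + (K - N))) T x.
    rewrite (big_cat_nat _ (n := P + (K - N))) ?leq_addr ?leq_add2l ?leq_subr //=.
    congr (_ + _); rewrite -[X in \sum_(X <= _ < _) _]add0n big_addn.
    by rewrite subnDl subKn.
  apply: (le_trans (rnormD _ _)).
  apply: le_trans (lerD (IH (K - N)%N _)
    (NP _ (fun n => c (n + (P + (K - N)))%N) (leq_addr _ _) (fun n => c1 _))) _.
    by rewrite ltn_subrL N0 (leq_trans N0).
  by rewrite natrB //; ilra.
have [N1 N1P] := nat_gt ((P%:R * X + N%:R * X) / (e / 2)).
exists (maxn N1 P) => K; rewrite geq_max => /andP[N1K PK] c c1.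
rewrite (big_cat_nat _ (n := P)) //=.
apply: (le_trans (rnormD _ _)).
have := tail (K - P)%N c c1; rewrite subnKC // => t1.
have t2 : rnorm (\sum_(0 <= i < P) c i *: iter i T x) <= P%:R * X.
  rewrite -[X in X%:R * _]subn0; apply: rnorm_sum_le => // n _ _.
  by rewrite rnormZ -[leRHS]mul1r ler_pM ?rnorm_ge0.
apply: (le_trans (lerD t2 t1)).
have t3 : P%:R * X + N%:R * X <= e / 2 * K%:R.
  rewrite [leRHS]mulrC -ler_pdivrMr //; apply: le_trans (ltW N1P) _.
  by rewrite ler_nat.
have : e / 2 * (K - P)%:R <= e / 2 * K%:R.
  by apply: ler_wpM2l; rewrite ?ler_nat ?leq_subr // ltW.
move: t3; ilra.
Qed.

End BaseCase.

(** * Van der Corput inequality on an interval [K, N) *)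

Lemma shift_window_le (K : numDomainType) (V : normedZmodType K) (v : nat -> V)
    (B : K) L D : (forall i, `|v i| <= B) ->
  `|\sum_(0 <= i < L) v (D + i)%N - \sum_(0 <= i < L) v i| <= 2 * B * D%:R.
Proof.
move=> vB; elim: D => [|D IH]; first by rewrite subrr normr0 mulr0.
rewrite -[D.+1%:R]natr1 mulrDr mulr1.
have -> : \sum_(0 <= i < L) v (D.+1 + i)%N =
    \sum_(0 <= i < L) v (D + i)%N + (v (D + L)%N - v D).
  apply: (addrI (v D)); rewrite [RHS]addrCA subrKC.
  transitivity (\sum_(0 <= i < L.+1) v (D + i)%N); last by rewrite big_nat_recr.
  by rewrite big_nat_recl // addn0; congr (_ + _); apply: eq_bigr => i _; rewrite addSnnS.
rewrite addrAC; apply: (le_trans (ler_normD _ _)); apply: lerD => //.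
by apply: (le_trans (ler_normB _ _)); rewrite mulr_natl mulr2n lerD.
Qed.

Section VanDerCorput.
Context {R : realType} {H : normedModType R[i]}.
Context (dotp : {dot H for Num.conj}).
Hypothesis dotpE : forall x : H, `|x| ^+ 2 = dotp x x.
Context (T : {linear H -> H}) (M : R).
Hypothesis M0 : 0 <= M.
Hypothesis TM : forall n u, rnorm (iter n T u) <= M * rnorm u.
Variable x : H.
Let X := M * rnorm x.

Let X0 : 0 <= X. Proof. by rewrite mulr_ge0 ?rnorm_ge0. Qed.

Lemma weighted_term_le (c : R[i]) k : rnorm c <= 1 ->
  rnorm (c *: iter k T x) <= X.
Proof. by move=> c1; rewrite rnormZ -[X]mul1r ler_pM ?rnorm_ge0 ?TM. Qed.

Lemma weighted_null_pred (a : nat -> nat) (e : R) : weighted_null T x a ->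
  0 < e -> exists N0, forall N, (N0 <= N)%N ->
  forall (P : pred nat) (c : nat -> R[i]), (forall n, rnorm (c n) <= 1) ->
  rnorm (\sum_(0 <= n < N | P n) c n *: iter (a n) T x) <= e * N%:R.
Proof.
move=> anull e0; have [N0 N0P] := anull _ e0; exists N0 => N NN P c c1.
rewrite big_mkcond (eq_bigr (fun n => (if P n then c n else 0) *: iter (a n) T x)).
  by apply: N0P => // n; case: ifP; rewrite ?rnorm0 ?ler01.
by move=> n _; case: ifP; rewrite ?scale0r.
Qed.

Section Block.
Variables (a : nat -> nat) (c : nat -> R[i]) (K N Q : nat) (eta del : R).
Hypothesis c1 : forall n, rnorm (c n) <= 1.
Hypothesis Q0 : (0 < Q)%N.
Hypothesis KN : (K <= N)%N.
Hypothesis a_mono : forall n h, (K <= n)%N -> (a n <= a (n + h))%N.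
Hypothesis aK0 : (0 < a K)%N.
Hypothesis eta0 : 0 <= eta.
Hypothesis del0 : 0 <= del.
(** Translating the averaging window of length [a K] by a (n + h) - a n changes only a proportion of
    order [eta] of it. *)
Hypothesis growth : forall n h, (K <= n < N)%N -> (h < Q)%N ->
  (a (n + h)%N - a n)%:R <= eta * (a K)%:R.
Hypothesis small_diff : forall h h' (d : nat -> R[i]), (h < h' < Q)%N ->
  (forall n, rnorm (d n) <= 1) ->
  rnorm (\sum_(K <= n < N) d n *: iter (a (n + h')%N - a (n + h)%N) T x) <= del * N%:R.

Let u n := \sum_(0 <= h < Q) c (n + h)%N *: iter (a (n + h)%N) T x.
(** Correlation of the terms [h] and [h'] of [u n] after the common part [a n] of the exponents has
    been replaced by each i < a K in turn; no such i exceeds [a n]. *)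
Let W h h' := \sum_(K <= n < N) \sum_(0 <= i < a K)
  rdot dotp (c (n + h)%N *: iter (a (n + h)%N - a n + i) T x)
            (c (n + h')%N *: iter (a (n + h')%N - a n + i) T x).

Let WC h h' : W h h' = W h' h.
Proof. by apply: eq_bigr => n _; apply: eq_bigr => i _; rewrite rdotC. Qed.

Let rdot_le (d d' : R[i]) k k' : rnorm d <= 1 -> rnorm d' <= 1 ->
  `|rdot dotp (d *: iter k T x) (d' *: iter k' T x)| <= X ^+ 2.
Proof.
move=> d1 d1'; apply: (le_trans (cauchy_schwarz dotpE _ _)).
by rewrite expr2 ler_pM ?rnorm_ge0 // weighted_term_le.
Qed.

Let W_diag h : W h h <= N%:R * (a K)%:R * X ^+ 2.
Proof.
apply: (@le_trans _ _ (\sum_(K <= n < N) \sum_(0 <= i < a K) X ^+ 2)).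
  apply: ler_sum => n _; apply: ler_sum => i _.
  by apply: le_trans (ler_norm _) _; exact: rdot_le.
rewrite !sumr_const_nat subn0 -[_ *+ (N - K)]mulr_natl -[X ^+ 2 *+ _]mulr_natl mulrA.
by rewrite ler_wpM2r ?sqr_ge0 // ler_wpM2r // ler_nat leq_subr.
Qed.

(** Translating the window so that the smaller exponent becomes [i] costs the [eta] term. The sum
    over [n] is then the inner product of T^i x with T^i of a weighted sum over the exponents [e n],
    which [small_diff] bounds. *)
Let W_off h h' : (h < h' < Q)%N ->
  W h h' <= N%:R * (a K)%:R * (2 * eta * X ^+ 2 + X * M * del).
Proof.
move=> hh'; have /andP[hlt h'Q] := hh'; have hQ := ltn_trans hlt h'Q.
pose e n := (a (n + h')%N - a (n + h)%N)%N.
pose phi n i := rdot dotp (c (n + h)%N *: iter i T x)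
                          (c (n + h')%N *: iter (i + e n) T x).
have phiX n i : `|phi n i| <= X ^+ 2 by exact: rdot_le.
have -> : W h h' = \sum_(K <= n < N) \sum_(0 <= i < a K) phi n (a (n + h)%N - a n + i)%N.
  apply: eq_big_nat => n /andP[Kn _]; apply: eq_bigr => i _; rewrite /phi.
  congr (rdot _ _ (_ *: iter _ _ _)); rewrite addnAC addnBAC ?a_mono //.
  rewrite [X in (_ = X + _)%N]addnC /e.
  have := a_mono h Kn; have := @a_mono (n + h) (h' - h) (leq_trans Kn (leq_addr _ _)).
  rewrite -addnA subnKC ?(ltnW hlt) //; lia.
apply: (@le_trans _ _ (\sum_(K <= n < N) (\sum_(0 <= i < a K) phi n i +
    2 * X ^+ 2 * (eta * (a K)%:R)))).
  rewrite !big_nat; apply: ler_sum => n KnN; rewrite -lerBlDl.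
  apply: le_trans (ler_norm _) _; apply: le_trans (shift_window_le _ _ (phiX n)) _.
  by apply: ler_wpM2l (growth KnN hQ); rewrite mulr_ge0 ?sqr_ge0.
rewrite big_split /= sumr_const_nat -[_ *+ (N - K)]mulr_natl exchange_big /=.
have main : \sum_(0 <= i < a K) \sum_(K <= n < N) phi n i <=
    (a K)%:R * (X * (M * (del * N%:R))).
  rewrite mulr_natl -{2}[a K]subn0 -sumr_const_nat; apply: ler_sum => i _.
  rewrite (_ : \sum_(K <= n < N) _ = rdot dotp (iter i T x) (iter i T
     (\sum_(K <= n < N) (((c (n + h)%N)^* )%R * c (n + h')%N) *: iter (e n) T x))).
    apply: le_trans (ler_norm _) _; apply: le_trans (cauchy_schwarz dotpE _ _) _.
    rewrite ler_pM ?rnorm_ge0 ?TM //; apply: le_trans (TM _ _) _.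
    rewrite ler_wpM2l //; apply: small_diff => // n.
    by rewrite rnormM rnorm_conj mulr_ile1 ?rnorm_ge0.
  rewrite iter_lin_sum rdot_sumr; apply: eq_bigr => n _.
  by rewrite /phi rdotZ iter_linZ iterD.
have : (N - K)%:R * (2 * X ^+ 2 * (eta * (a K)%:R)) <=
    N%:R * (2 * X ^+ 2 * (eta * (a K)%:R)).
  by apply: ler_wpM2r; [nneg | rewrite ler_nat leq_subr].
by move=> h1; apply: le_trans (lerD main h1) _; rewrite le_eqVlt; apply/orP; left;
  apply/eqP; ring.
Qed.

(** For each i < a K, [u n] is T^(a n - i) of the block with exponents lowered by a n - i; averaging
    over [i] gives the sum of all [W h h'] up to M^2. The [Q] diagonal terms are bounded
    trivially. *)
Let sum_sqr_le : \sum_(K <= n < N) rnorm (u n) ^+ 2 <=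
  M ^+ 2 * (N%:R * Q%:R * X ^+ 2 +
            N%:R * Q%:R ^+ 2 * (2 * eta * X ^+ 2 + X * M * del)).
Proof.
have aKR : 0 < (a K)%:R :> R by rewrite ltr0n.
have step n i : (K <= n < N)%N -> (i < a K)%N -> rnorm (u n) ^+ 2 <= M ^+ 2 *
   \sum_(0 <= h < Q) \sum_(0 <= h' < Q)
   rdot dotp (c (n + h)%N *: iter (a (n + h)%N - a n + i) T x)
             (c (n + h')%N *: iter (a (n + h')%N - a n + i) T x).
  move=> /andP[Kn _] iK; rewrite -rnorm_sum_sqr // -exprMn.
  rewrite ler_pXn2r ?nnegrE ?rnorm_ge0 ?mulr_ge0 ?rnorm_ge0 //.
  have ian : (i <= a n)%N.
    by rewrite (leq_trans (ltnW iK)) // -(subnKC Kn) a_mono.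
  apply: le_trans _ (TM (a n - i) _); rewrite le_eqVlt; apply/orP; left; apply/eqP.
  congr rnorm; rewrite iter_lin_sum; apply: eq_bigr => h _.
  rewrite iter_linZ -iterD; congr (_ *: iter _ _ _).
  by rewrite addnCA subnK // subnK // a_mono.
rewrite -(ler_pM2l aKR).
have -> : (a K)%:R * \sum_(K <= n < N) rnorm (u n) ^+ 2 =
    \sum_(K <= n < N) \sum_(0 <= i < a K) rnorm (u n) ^+ 2.
  by rewrite mulr_sumr; apply: eq_bigr => n _; rewrite sumr_const_nat subn0 mulr_natl.
apply: (@le_trans _ _ (M ^+ 2 * \sum_(0 <= h < Q) \sum_(0 <= h' < Q) W h h')).
  apply: (@le_trans _ _ (\sum_(K <= n < N) \sum_(0 <= i < a K) M ^+ 2 *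
   \sum_(0 <= h < Q) \sum_(0 <= h' < Q)
   rdot dotp (c (n + h)%N *: iter (a (n + h)%N - a n + i) T x)
             (c (n + h')%N *: iter (a (n + h')%N - a n + i) T x))).
    rewrite !big_nat; apply: ler_sum => n KnN; rewrite !big_nat.
    by apply: ler_sum => i /andP[_ iK]; exact: step.
  rewrite le_eqVlt; apply/orP; left; apply/eqP.
  under eq_bigr do rewrite -mulr_sumr exchange_big /=.
  rewrite -mulr_sumr exchange_big /=; congr (_ * _); apply: eq_bigr => h _.
  under eq_bigr do rewrite exchange_big /=.
  by rewrite exchange_big.
rewrite mulrCA; apply: ler_wpM2l; first exact: sqr_ge0.
pose F := N%:R * (a K)%:R * (2 * eta * X ^+ 2 + X * M * del).
have F0 : 0 <= F.
  by rewrite /F; nneg.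
apply: (@le_trans _ _ (\sum_(0 <= h < Q) (N%:R * (a K)%:R * X ^+ 2 + Q%:R * F))).
  rewrite !big_nat; apply: ler_sum => h /andP[_ hQ].
  rewrite (bigD1_seq h) ?mem_index_iota ?hQ ?iota_uniq //=; apply: lerD; first exact: W_diag.
  apply: (@le_trans _ _ (\sum_(0 <= h' < Q) F)); last first.
    by rewrite sumr_const_nat subn0 mulr_natl.
  rewrite big_mkcond !big_nat; apply: ler_sum => h' /andP[_ h'Q].
  case: ltngtP => // hh'; first by rewrite WC; apply: W_off; rewrite hh'.
  by apply: W_off; rewrite hh'.
rewrite sumr_const_nat subn0 -[leLHS]mulr_natl le_eqVlt; apply/orP; left; apply/eqP.
by rewrite /F; ring.
Qed.

(** Up to end effects of size 2 Q X, the sum is 1/Q times that of the [u n]; Young's inequality with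
    parameter z Q passes from their norms to the squares in [sum_sqr_le]. *)
Lemma block_sum_le (z : R) : 0 < z ->
  rnorm (\sum_(K <= n < N) c n *: iter (a n) T x) <=
  N%:R * (z / 2 + M ^+ 2 * X ^+ 2 / (2 * z * Q%:R) +
          M ^+ 2 * (2 * eta * X ^+ 2 + X * M * del) / (2 * z)) + 2 * Q%:R * X.
Proof.
move=> z0; set S := \sum_(K <= n < N) _.
have QR : 0 < Q%:R :> R by rewrite ltr0n.
pose v n := c n *: iter (a n) T x.
have vX n : `|v n| <= X%:C by rewrite rnormE lecR weighted_term_le.
have SK h : \sum_(K <= n < N) v (n + h)%N = \sum_(0 <= i < N - K) v (K + (h + i))%N.
  rewrite -{1}[K]add0n big_addn; apply: eq_bigr => i _.
  by congr v; rewrite addnC [RHS]addnC addnA.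
have S0 : S = \sum_(0 <= i < N - K) v (K + i)%N.
  by rewrite /S -{1}[K]add0n big_addn; apply: eq_bigr => i _; rewrite addnC.
have err h : (h < Q)%N -> rnorm (S - \sum_(K <= n < N) v (n + h)%N) <= 2 * Q%:R * X.
  move=> hQ; rewrite rdistC SK S0 rnorm_le.
  apply: le_trans (shift_window_le (v := fun i => v (K + i)%N) _ _ (fun i => vX _)) _.
  rewrite -(rmorph_nat (real_complex R) 2) -(rmorph_nat (real_complex R) h) -2!rmorphM lecR.
  by rewrite mulrAC; apply: ler_wpM2r => //; apply: ler_wpM2l => //; rewrite ler_nat ltnW.
have QS : Q%:R * rnorm S <= \sum_(K <= n < N) rnorm (u n) + Q%:R * (2 * Q%:R * X).
  rewrite -rnormZr // (_ : _ *: S = \sum_(K <= n < N) u n +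
      \sum_(0 <= h < Q) (S - \sum_(K <= n < N) v (n + h)%N)); last first.
    rewrite sumrB sumr_const_nat subn0 /u [X in X + _]exchange_big /= addrC subrK.
    by rewrite rmorph_nat scaler_nat.
  apply: le_trans (rnormD _ _) (lerD (rnorm_sum _ _ _) _).
  rewrite -{2}[Q]subn0; apply: rnorm_sum_le => [|h /andP[_ hQ] _]; last exact: err.
  by nneg.
have young n : rnorm (u n) <= z * Q%:R / 2 + rnorm (u n) ^+ 2 / (2 * z * Q%:R).
  move: (rnorm _) => b; rewrite -subr_ge0.
  have -> : z * Q%:R / 2 + b ^+ 2 / (2 * z * Q%:R) - b =
    (z * Q%:R - b) ^+ 2 / (2 * z * Q%:R).
    by field; rewrite !gt_eqF.
  by nneg.
have Su : \sum_(K <= n < N) rnorm (u n) <= N%:R * (z * Q%:R / 2) +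
   M ^+ 2 * (N%:R * Q%:R * X ^+ 2 +
     N%:R * Q%:R ^+ 2 * (2 * eta * X ^+ 2 + X * M * del)) / (2 * z * Q%:R).
  apply: le_trans (ler_sum _ (fun n _ => young n)) _.
  rewrite big_split /= sumr_const_nat -[X in X + _ <= _]mulr_natl -mulr_suml.
  apply: lerD; first by apply: ler_wpM2r; [nneg | rewrite ler_nat leq_subr].
  by apply: ler_wpM2r sum_sqr_le; rewrite invr_ge0; nneg.
rewrite -(ler_pM2l QR); apply: le_trans QS _; apply: le_trans (lerD Su (lexx _)) _.
by rewrite le_eqVlt; apply/orP; left; apply/eqP; field; rewrite !gt_eqF.
Qed.

End Block.
End VanDerCorput.

(** * Passing from one exponent sequence to another *)

Section Transfer.
Context {R : realType} {H : normedModType R[i]}.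
Context (T : {linear H -> H}) (M : R).
Hypothesis M0 : 0 <= M.
Hypothesis TM : forall n u, rnorm (iter n T u) <= M * rnorm u.
Variable x : H.
Let X := M * rnorm x.

Let X0 : 0 <= X. Proof. by rewrite mulr_ge0 ?rnorm_ge0. Qed.

Lemma initial_sum_le (a : nat -> nat) (c : nat -> R[i]) K :
  (forall n, rnorm (c n) <= 1) ->
  rnorm (\sum_(0 <= n < K) c n *: iter (a n) T x) <= K%:R * X.
Proof.
move=> c1; rewrite -{2}[K]subn0; apply: rnorm_sum_le => // n _ _.
exact: weighted_term_le.
Qed.

Lemma weighted_null_tail (a : nat -> nat) n0 :
  (forall e : R, 0 < e -> exists N0, forall N, (N0 <= N)%N -> (n0 <= N)%N ->
   forall c : nat -> R[i], (forall n, rnorm (c n) <= 1) ->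
   rnorm (\sum_(n0 <= n < N) c n *: iter (a n) T x) <= e * N%:R) ->
  weighted_null T x a.
Proof.
move=> tl e e0; have e2 : 0 < e / 2 by rewrite divr_gt0.
have [N0 N0P] := tl _ e2; have [N1 N1P] := nat_gt (n0%:R * X / (e / 2)).
exists (maxn (maxn N0 N1) n0) => N; rewrite !geq_max -andbA => /and3P[N0N N1N nN] c c1.
rewrite (big_cat_nat _ (n := n0)) //=; apply: le_trans (rnormD _ _) _.
have h1 := initial_sum_le a n0 c1; have h2 := N0P _ N0N nN c c1.
have h3 : n0%:R * X <= e / 2 * N%:R.
  rewrite [leRHS]mulrC -ler_pdivrMr //; apply: le_trans (ltW N1P) _.
  by rewrite ler_nat.
by apply: le_trans (lerD h1 h2) _; move: h3; ilra.
Qed.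

(** The indices are split by whether a n = r n; on the others one factor [T] is pulled out of the
    sum. This absorbs rounding errors of integer parts. *)
Lemma weighted_null_succ (r a : nat -> nat) n0 : weighted_null T x r ->
  (forall n, (n0 <= n)%N -> a n = r n \/ a n = (r n).+1) -> weighted_null T x a.
Proof.
move=> rnull ar; apply: (@weighted_null_tail _ n0) => e e0.
have [d d0 dP] := small_factor (addr_ge0 M0 ler01) e0.
have [N0 N0P] := weighted_null_pred rnull d0.
exists N0 => N NN nN c c1.
pose P1 n := (n0 <= n)%N && (a n == r n).
pose P2 n := (n0 <= n)%N && (a n != r n).
have -> : \sum_(n0 <= n < N) c n *: iter (a n) T x =
   \sum_(0 <= n < N | P1 n) c n *: iter (r n) T x +
   T (\sum_(0 <= n < N | P2 n) c n *: iter (r n) T x).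
  rewrite (linear_sum T) /=.
  rewrite [X in _ = X + _](eq_bigr (fun n => c n *: iter (a n) T x)); last first.
    by move=> n /andP[_ /eqP ->].
  rewrite [X in _ = _ + X](eq_bigr (fun n => c n *: iter (a n) T x)); last first.
    move=> n /andP[n0n]; have [->|->] := ar _ n0n; first by rewrite eqxx.
    by rewrite linearZ.
  rewrite (big_nat_widenl n0 0) //= (bigID (fun n => a n == r n)) /=.
  by congr (_ + _); apply: eq_bigl => n; rewrite /P1 /P2 ?andTb.
apply: le_trans (rnormD _ _) _.
apply: le_trans (lerD (N0P _ NN P1 c c1) (TM 1 _)) _.
apply: le_trans (lerD (lexx _) (ler_wpM2l M0 (N0P _ NN P2 c c1))) _.
rewrite mulrA -mulrDl; apply: ler_wpM2r => //.
by apply: le_trans dP; rewrite mulrDl mul1r addrC.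
Qed.

Lemma trunc_sub_cases (s t : R) : 0 <= s -> s <= t ->
  (Num.trunc t - Num.trunc s = Num.trunc (t - s) \/
   Num.trunc t - Num.trunc s = (Num.trunc (t - s)).+1)%N.
Proof.
move=> s0 st; have t0 := le_trans s0 st.
have ts0 : 0 <= t - s by rewrite subr_ge0.
have /andP[s1 s2] := truncn_itv s0; have /andP[t1 t2] := truncn_itv t0.
have /andP[r1 r2] := truncn_itv ts0.
set p := Num.trunc s in s1 s2 *; set q := Num.trunc t in t1 t2 *.
set r := Num.trunc (t - s) in r1 r2 *.
have h1 : (p + r < q.+1)%N.
  by rewrite -(ltr_nat R) natrD; move: s1 t2 r1; ilra.
have h2 : (q < p.+1 + r.+1)%N.
  by rewrite -(ltr_nat R) natrD; move: s2 t1 r2; ilra.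
by move: h1 h2; clear; lia.
Qed.

(** Van der Corput produces differences of integer parts, whereas the induction concerns integer
    parts of differences; the two differ by 0 or 1. *)
Lemma weighted_null_trunc_diff (b : nat -> R) n0 h :
  (forall n, (n0 <= n)%N -> 0 <= b n <= b (n + h)%N) ->
  weighted_null T x (fun n => Num.trunc (b (n + h)%N - b n)) ->
  weighted_null T x (fun n => Num.trunc (b (n + h)%N) - Num.trunc (b n))%N.
Proof.
move=> bP /weighted_null_succ; apply => n /bP /andP[b0 bb].
exact: trunc_sub_cases.
Qed.

Lemma count_window_le (P : pred nat) m N W :
  (forall n n', (m <= n < N)%N -> (n <= n' < N)%N -> P n -> P n' ->
    (n' <= n + W)%N) ->
  (count P (index_iota m N) <= W.+1)%N.
Proof.
move=> PW; have [/hasP [n0 n0m Pn0]|/hasPn nP] := boolP (has P (index_iota m N)); last first.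
  rewrite (@eq_in_count _ _ pred0) ?count_pred0 // => n /nP; exact: negbTE.
have exP : exists n, P n && (m <= n < N)%N.
  by exists n0; rewrite Pn0 -mem_index_iota.
case: (ex_minnP exP) => p /andP[Pp pmN] pmin.
rewrite -size_filter -(size_iota p W.+1); apply: uniq_leq_size.
  by rewrite filter_uniq // iota_uniq.
move=> n; rewrite mem_filter mem_index_iota mem_iota => /andP[Pn nmN].
have pn : (p <= n)%N by apply: pmin; rewrite Pn.
by rewrite pn addnS ltnS; apply: PW => //; rewrite pn; case/andP: nmN.
Qed.

(* Equal values of the exponent are grouped; s N bounds from below the slope of
   b on [n0, N], hence 1 + 1 / s N the size of the groups. *)
Lemma weighted_null_slow (b s : nat -> R) (A : R) n0 :
  weighted_null T x id ->
  (forall n N, (n0 <= n <= N)%N -> 0 <= b n <= b N) ->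
  (forall B, exists2 n, (n0 <= n)%N & B <= b n) ->
  (forall N, (n0 <= N)%N -> 0 < s N) ->
  (forall n n' N, (n0 <= n)%N -> (n <= n' < N)%N ->
    (n' - n)%:R * s N <= b n' - b n) ->
  (forall N, (n0 <= N)%N -> (1 + (s N)^-1) * (b N + 1) <= A * N%:R) ->
  weighted_null T x (fun n => Num.trunc (b n)).
Proof.
move=> idnull bmono binf s0 slope bA; apply: (@weighted_null_tail _ n0) => e e0.
have [d d0 dP] := small_factor (normr_ge0 A) e0.
have [N1 N1P] := idnull _ d0.
have [N2 n0N2 N2P] := binf N1%:R.
exists N2 => N N2N nN c c1.
have sN := s0 _ nN.
have /andP[bN0 _] : 0 <= b N <= b N by apply: bmono; rewrite nN leqnn.
(* Two indices with equal integer part have values of [b] less than 1 apart, hence are at most 1/s N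
   apart: a group has at most W + 1 members. *)
pose W := Num.trunc (s N)^-1; pose a n := Num.trunc (b n); pose L := (a N).+1.
have si0 : 0 <= (s N)^-1 by rewrite invr_ge0 ltW.
have /andP[W1 W2] := truncn_itv si0; rewrite -/W in W1 W2.
pose D k := \sum_(n0 <= n < N | a n == k) c n.
have DW k : rnorm (D k) <= W.+1%:R.
  apply: le_trans (rnorm_sum _ _ _) _.
  apply: (@le_trans _ _ (\sum_(n0 <= n < N | a n == k) 1)).
    by apply: ler_sum => n _; exact: c1.
  rewrite big_const_seq iter_addr_0 ler_nat; apply: count_window_le.
  move=> n n' /andP[n0n _] /andP[nn' n'N] /eqP an /eqP an'.
  rewrite -leq_subLR truncn_ge_nat // -[leRHS]mul1r ler_pdivlMr //.
  apply: le_trans (slope _ _ _ n0n (introT andP (conj nn' n'N))) _.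
  have nN' : (n <= N)%N := ltnW (leq_ltn_trans nn' n'N).
  have n'N' : (n' <= N)%N := ltnW n'N.
  have /andP[bn0 _] := bmono n N (introT andP (conj n0n nN')).
  have /andP[bn0' _] := bmono n' N (introT andP (conj (leq_trans n0n nn') n'N')).
  have /andP[] := truncn_itv bn0; have /andP[] := truncn_itv bn0'.
  by rewrite -/(a n) -/(a n') an an' -natr1; ilra.
(* Dividing the grouped weights by W + 1 makes them admissible for [idnull] on the [L] values k <= a
   N; [bA] bounds the product (W + 1) L by a multiple of [N]. *)
pose c' k := (W.+1%:R^-1)%:C * D k.
have W0 : 0 < W.+1%:R :> R by [].
have c'1 k : rnorm (c' k) <= 1.
  by rewrite rnormM rnormC ger0_norm ?invr_ge0 // ler_pdivrMl // mulr1.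
have -> : \sum_(n0 <= n < N) c n *: iter (a n) T x =
    W.+1%:R%:C *: \sum_(0 <= k < L) c' k *: iter k T x.
  rewrite scaler_sumr; under [RHS]eq_bigr => k _.
    rewrite scalerA mulrA -rmorphM mulfV ?gt_eqF // rmorph1 mul1r.
    rewrite /D scaler_suml big_mkcond /=; over.
  rewrite exchange_big /=; apply: eq_big_nat => n /andP[n0n nN'].
  rewrite -big_mkcond /=.
  under eq_bigl do rewrite eq_sym.
  rewrite big_nat1_eq leq0n /= ifT // ltnS.
  apply: le_truncn; by case/andP: (bmono n N (introT andP (conj n0n (ltnW nN')))).
rewrite rnormZr //.
have aN : (a N)%:R <= b N by rewrite truncn_le.
have NL : (N1 <= L)%N.
  rewrite leqW // truncn_ge_nat // (le_trans N2P) //.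
  by have /andP[] := bmono N2 N (introT andP (conj n0N2 N2N)).
apply: (@le_trans _ _ (W.+1%:R * (d * L%:R))).
  by rewrite ler_wpM2l // N1P.
apply: le_trans (_ : d * ((1 + (s N)^-1) * (b N + 1)) <= _).
  rewrite mulrCA ler_wpM2l ?(ltW d0) //; apply: ler_pM => //.
    by rewrite -natr1; move: W1; ilra.
  by rewrite -natr1; move: aN; ilra.
apply: le_trans (ler_wpM2l (ltW d0) (bA _ nN)) _.
rewrite mulrA; apply: ler_wpM2r => //; apply: le_trans dP.
by rewrite mulrC ler_wpM2r ?(ltW d0) // ler_norm.
Qed.

End Transfer.

(** * Van der Corput theorem for null sequences *)

Section VanDerCorputTheorem.
Context {R : realType} {H : normedModType R[i]}.
Context (dotp : {dot H for Num.conj}).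
Hypothesis dotpE : forall x : H, `|x| ^+ 2 = dotp x x.
Context (T : {linear H -> H}) (M : R).
Hypothesis M0 : 0 <= M.
Hypothesis TM : forall n u, rnorm (iter n T u) <= M * rnorm u.
Variable x : H.
Let X := M * rnorm x.

Let X0 : 0 <= X. Proof. by rewrite mulr_ge0 ?rnorm_ge0. Qed.

(** Reindexing by n + h turns the exponent into a difference of lag h' - h, and only the finitely
    many lags below [Q] occur. The reindexed sum reaches N + h <= 2 N, whence the use of d/2. *)
Lemma weighted_null_diff_uniform (a : nat -> nat) Q (d : R) : 0 < d ->
  (forall h, (0 < h)%N -> weighted_null T x (fun n => a (n + h) - a n)%N) ->
  exists N0, forall K N, (K <= N)%N -> (N0 <= N)%N ->
  forall h h' (c : nat -> R[i]), (h < h' < Q)%N -> (forall n, rnorm (c n) <= 1) ->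
  rnorm (\sum_(K <= n < N) c n *: iter (a (n + h')%N - a (n + h)%N) T x) <= d * N%:R.
Proof.
move=> d0 anull; have d2 : 0 < d / 2 by rewrite divr_gt0.
have NP h : exists N0, (0 < h)%N -> forall N, (N0 <= N)%N ->
  forall (P : pred nat) (c : nat -> R[i]), (forall n, rnorm (c n) <= 1) ->
  rnorm (\sum_(0 <= n < N | P n) c n *: iter (a (n + h)%N - a n) T x) <= d / 2 * N%:R.
  have [h0|//] := posnP h; first by exists 0%N; rewrite h0.
  by move=> /anull h0; have [N0 N0P] := weighted_null_pred h0 d2; exists N0.
have [N0 N0P] := choice NP.
exists (maxn Q (\max_(h < Q) N0 h)) => K N KN.
rewrite geq_max => /andP[QN maxN] h h' c /andP[hh' h'Q] c1.
have -> : \sum_(K <= n < N) c n *: iter (a (n + h')%N - a (n + h)%N) T x =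
  \sum_(0 <= n < N + h | (K + h <= n)%N) c (n - h)%N *: iter (a (n + (h' - h))%N - a n) T x.
  rewrite -(big_nat_widenl (K + h)%N 0%N (N + h)%N predT) // big_addn addnK.
  apply: eq_bigr => n _; rewrite addnK; congr (_ *: iter (a _ - _) _ _).
  by rewrite -addnA subnKC // ltnW.
have hQ := ltn_trans hh' h'Q.
apply: le_trans (N0P (h' - h)%N _ _ _ _ (fun n => c (n - h)%N) _) _ => //.
- by rewrite subn_gt0.
- apply: leq_trans (leq_addr _ _); apply: leq_trans maxN.
  have lt : (h' - h < Q)%N by apply: leq_ltn_trans h'Q; exact: leq_subr.
  exact: (leq_bigmax (F := fun i : 'I_Q => N0 i) (Ordinal lt)).
- rewrite -mulrA ler_pM2l // ler_pdivrMl // -natrM ler_nat mul2n -addnn leq_add2l.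
  by rewrite (leq_trans (ltnW hQ)).
Qed.

(* The averaging over shifts replaces the isometry assumption of the usual van
   der Corput argument. *)
Theorem van_der_corput (a : nat -> nat) n0 :
  (forall n h, (n0 <= n)%N -> (a n <= a (n + h))%N) ->
  (forall h, (0 < h)%N -> weighted_null T x (fun n => a (n + h) - a n)%N) ->
  (forall (k Q : nat) (eta : R), 0 < eta -> exists K0, forall K, (K0 <= K)%N ->
     (0 < a K)%N /\ forall n, (K <= n < k * K)%N ->
     (a (n + Q)%N - a n)%:R <= eta * (a K)%:R) ->
  weighted_null T x a.
Proof.
move=> a_mono anull growth e e0.
(* Shares of [e]: 1/4 for the initial segment, 1/4 for z/2, 1/8 for the diagonal ([Q]), 1/16 each
   for [eta] and [d], and 1/8 for the end effects. *)
pose z := e / 2; have z0 : 0 < z by rewrite divr_gt0.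
have e8 : 0 < e / 8 by rewrite divr_gt0.
have e16 : 0 < e / 16 by rewrite divr_gt0.
have [k0 k0P] := nat_gt (X / (e / 8)).
have [Q0 Q0P] := nat_gt (M ^+ 2 * X ^+ 2 / (2 * z) / (e / 8)).
pose Q := Q0.+1; pose k := k0.+2.
have kP : X / k%:R <= e / 8.
  rewrite ler_pdivrMr // [leRHS]mulrC -ler_pdivrMr // (le_trans (ltW k0P)) //.
  by rewrite ler_nat /k; apply: leqW.
have QP : M ^+ 2 * X ^+ 2 / (2 * z * Q%:R) <= e / 8.
  rewrite invfM mulrA ler_pdivrMr // [leRHS]mulrC -ler_pdivrMr //.
  by rewrite (le_trans (ltW Q0P)) // ler_nat.
have [|eta eta0 etaP] := @small_factor _ (M ^+ 2 * (2 * X ^+ 2) / (2 * z)) _ _ e16.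
  by nneg.
have [|d d0 dP] := @small_factor _ (M ^+ 2 * (X * M) / (2 * z)) _ _ e16.
  by nneg.
have [K0 K0P] := growth k Q eta eta0.
have [N0 N0P] := weighted_null_diff_uniform Q d0 anull.
have [N1 N1P] := nat_gt (X / (e / 8)).
have [N2 N2P] := nat_gt (2 * Q%:R * X / (e / 8)).
exists (maxn (maxn (k * maxn K0 n0) N0) (maxn 1 (maxn N1 N2))) => N.
rewrite !geq_max => /andP[/andP[kN N0N] /and3P[N0' N1N N2N]] c c1.
(* [K] is just above N/k: the first [K] terms are a small proportion, and N < k K puts [K, N) in the
   range of [growth]. *)
pose K := (N %/ k).+1.
have KK0 : (maxn K0 n0 <= K)%N by rewrite leqW // leq_divRL // mulnC.
move: KK0; rewrite geq_max => /andP[K0K n0K].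
have KN : (K <= N)%N by apply: ltn_Pdiv.
have NkK : (N < k * K)%N by rewrite mulnC; exact: ltn_ceil.
have [aK0 aKg] := K0P _ K0K.
have a_monoK n h : (K <= n)%N -> (a n <= a (n + h))%N.
  by move=> Kn; apply: a_mono; exact: leq_trans Kn.
have gr n h : (K <= n < N)%N -> (h < Q)%N -> (a (n + h)%N - a n)%:R <= eta * (a K)%:R.
  move=> /andP[Kn nN] hQ.
  apply: le_trans (aKg n _); last by rewrite Kn (ltn_trans nN).
  have nQ : (n + Q = n + h + (Q - h))%N by rewrite -addnA subnKC // ltnW.
  rewrite ler_nat; apply: leq_sub2r; rewrite nQ; apply: a_monoK.
  by rewrite (leq_trans Kn) // leq_addr.
have blk := block_sum_le dotpE M0 TM c1 (ltn0Sn Q0) KN a_monoK aK0 (ltW eta0) (ltW d0)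
  gr (N0P K N KN N0N) z0.
rewrite (big_cat_nat _ (n := K)) //=; apply: le_trans (rnormD _ _) _.
have ini := initial_sum_le M0 TM x a K c1.
apply: le_trans (lerD ini blk) _; rewrite -/X -/Q.
have NR : 0 <= N%:R :> R by [].
have t1 : K%:R * X <= e / 4 * N%:R.
  have : X <= e / 8 * N%:R.
    rewrite [leRHS]mulrC -ler_pdivrMr // (le_trans (ltW N1P)) // ler_nat //.
  have : (N %/ k)%:R * X <= e / 8 * N%:R.
    have := ler_wpM2r NR kP; apply: le_trans.
    rewrite mulrAC [X * _]mulrC mulrAC; apply: ler_wpM2r => //.
    by rewrite ler_pdivlMr // -natrM ler_nat leq_trunc_div.
  by rewrite /K -[(N %/ k).+1%:R]natr1 mulrDl mul1r; ilra.
have t2 : 2 * Q%:R * X <= e / 8 * N%:R.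
  by rewrite [leRHS]mulrC -ler_pdivrMr // (le_trans (ltW N2P)) // ler_nat.
have t3 : M ^+ 2 * (2 * eta * X ^+ 2 + X * M * d) / (2 * z) <= e / 8.
  have := lerD etaP dP; rewrite (_ : e / 16 + e / 16 = e / 8); last by field.
  apply: le_trans; rewrite le_eqVlt; apply/orP; left; apply/eqP.
  by field; rewrite gt_eqF.
have t4 : z / 2 + M ^+ 2 * X ^+ 2 / (2 * z * Q%:R) +
   M ^+ 2 * (2 * eta * X ^+ 2 + X * M * d) / (2 * z) <= e / 2.
  have -> : e / 2 = e / 4 + e / 8 + e / 8 by field.
  apply: lerD t3; apply: lerD QP; rewrite /z; lra.
apply: le_trans (lerD t1 (lerD (ler_wpM2l NR t4) t2)) _.
move: NR e0; nra.
Qed.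

End VanDerCorputTheorem.

(** * Differential inequalities for functions of class P_m *)

Section SlowClass.
Context {R : realType}.
Implicit Types (f df : R -> R) (F : nat -> R -> R) (s t C : R).

Lemma mean_value f df t0 s t :
  (forall r, t0 <= r -> is_derive r 1 f (df r)) -> t0 <= s -> s <= t ->
  exists2 r, s <= r <= t & f t - f s = df r * (t - s).
Proof.
move=> fdf ts st.
have [x xst||r rst E] := @MVT_segment _ f df s t st.
- apply: fdf; apply: le_trans ts _; move: xst; rewrite in_itv /= => /andP[/ltW //].
- apply: derivable_within_continuous => x; rewrite in_itv /= => /andP[sx _].
  by have [] := fdf x (le_trans ts sx).
- by exists r => //; move: rst; rewrite in_itv.
Qed.

(* The data retained from f in P_(m.+1), with F k the k-th derivative of f;
   unlike P_(m.+1), it is visibly stable under f |-> f (t + h) - f t. *)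
Definition slow_class m t0 C F : Prop :=
  [/\ forall k t, (k <= m)%N -> t0 <= t -> is_derive t 1 (F k) (F k.+1 t),
      forall k t, (k <= m.+1)%N -> t0 <= t -> 0 < F k t,
      forall t, t0 <= t -> F m t <= C * t * F m.+1 t &
      forall s t, t0 <= s -> s <= t -> F m.+1 t <= C * F m.+1 s].

Definition diffF (h : R) F k t := F k (t + h) - F k t.

Lemma is_derive_shift_diff f df t0 h t : 0 <= h ->
  (forall r, t0 <= r -> is_derive r 1 f (df r)) -> t0 <= t ->
  is_derive t 1 (fun r => f (r + h) - f r) (df (t + h) - df t).
Proof.
move=> h0 fdf tt.
have th : t0 <= t + h by rewrite (le_trans tt) // lerDl.
apply: is_deriveB; last exact: fdf.
have := @is_derive1_comp _ f (shift h) t _ _ (fdf _ th) (is_derive_shift t 1 h).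
by rewrite mulr1.
Qed.

(** The mean value theorem writes each difference as [h] times the next derivative, which gives
    positivity. The constant covers 2 C, from t + h <= 2 t in the third condition, and C + 1, from
    overlapping intervals in the fourth. *)
Lemma slow_class_diff m t0 C F h : 0 < h -> 1 <= t0 -> 0 <= C ->
  slow_class m.+1 t0 C F -> slow_class m (t0 + h) (2 * C + 1) (diffF h F).
Proof.
move=> h0 t01 C0 [Fd Fpos Fle Fdec].
have th t : t0 + h <= t -> t0 <= t by move: h0; ilra.
have mv k s t : (k <= m.+1)%N -> t0 <= s -> s <= t ->
   exists2 r, s <= r <= t & F k t - F k s = F k.+1 r * (t - s).
  by move=> km; apply: mean_value => r; exact: Fd.
have mvh k t : (k <= m.+1)%N -> t0 <= t ->
   exists2 r, t <= r <= t + h & diffF h F k t = F k.+1 r * h.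
  move=> km tt; have [|r rt E] := mv k t (t + h) km tt; first by rewrite lerDl ltW.
  by exists r => //; rewrite /diffF E addrAC subrr add0r.
split.
- move=> k t km /th tt; apply: is_derive_shift_diff (ltW h0) _ tt => r.
  by apply: Fd; exact: leqW.
- move=> k t km /th tt; have [r /andP[tr _] ->] := mvh k t km tt.
  by rewrite mulr_gt0 // Fpos // (le_trans tt).
- move=> t tt; have tt0 := th _ tt.
  have th' : t0 <= t + h by move: tt0 h0; ilra.
  apply: (@le_trans _ _ (C * (t + h) * diffF h F m.+1 t)); last first.
    have d0 : 0 <= diffF h F m.+1 t.
      have [r /andP[tr _] ->] := mvh m.+1 t (leqnn _) tt0.
      by rewrite mulr_ge0 ?(ltW h0) // ltW // Fpos // (le_trans tt0).
    apply: ler_wpM2r => //.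
    have : t + h <= 2 * t by move: tt t01 ; ilra.
    by move=> /(ler_wpM2l C0); move: tt t01 h0; ilra.
  (* [G] is nondecreasing on [t, t + h], since there C r F^(m+2)(r) is at most C (t + h) F^(m+2)(r);
     comparing its end values gives the claim. *)
  pose G r := C * (t + h) * F m.+1 r - F m r.
  pose dG r := C * (t + h) * F m.+2 r - F m.+1 r.
  have Gd r : t0 <= r -> is_derive r 1 G (dG r).
    move=> rt; have d1 := Fd _ _ (leqnn _) rt; have d2 := Fd _ _ (leqnSn _) rt.
    by apply: is_deriveB; exact: is_deriveZ.
  have [|r /andP[tr rth] E] := mean_value Gd tt0 (t := t + h).
    by rewrite lerDl ltW.
  have rt0 : t0 <= r := le_trans tt0 tr.
  have dG0 : 0 <= dG r.
    rewrite subr_ge0; apply: le_trans (Fle _ rt0) _.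
    by apply: ler_wpM2r; [exact/ltW/Fpos | exact: ler_wpM2l].
  have : 0 <= dG r * (t + h - t) by rewrite mulr_ge0 // subr_ge0 lerDl ltW.
  by rewrite -E /G /diffF; ilra.
- move=> s t /th ss st; have tt0 := le_trans ss st.
  have ws0 : 0 <= diffF h F m.+1 s.
    have [r /andP[sr _] ->] := mvh m.+1 s (leqnn _) ss.
    by rewrite mulr_ge0 ?(ltW h0) // ltW // Fpos // (le_trans ss).
  have far u : s + h <= u -> diffF h F m.+1 u <= C * diffF h F m.+1 s.
    move=> su; have uu : t0 <= u by move: ss su h0; ilra.
    have [r /andP[ur _] ->] := mvh m.+1 u (leqnn _) uu.
    have [q /andP[sq qs] ->] := mvh m.+1 s (leqnn _) ss.
    rewrite mulrA ler_pM2r // Fdec ?(le_trans ss sq) //.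
    by rewrite (le_trans qs) // (le_trans su).
  (* If t < s + h the mean value points need not be ordered; monotonicity instead bounds the
     difference at [t] by F(s + 2h) - F(s), the sum of the differences at [s] and at [s + h]. *)
  have [sht|tsh] := leP (s + h) t; first by have := far _ sht; nra.
  have incr u v : t0 <= u -> u <= v -> F m.+1 u <= F m.+1 v.
    move=> uu uv; have [r /andP[ur _] E] := mv m.+1 u v (leqnn _) uu uv.
    by rewrite -subr_ge0 E mulr_ge0 ?subr_ge0 // ltW // Fpos // (le_trans uu).
  have := far (s + h) (lexx _).
  have : F m.+1 (t + h) <= F m.+1 (s + h + h).
    by apply: incr; move: tt0 tsh h0; ilra.
  have := incr s t ss st.
  by rewrite /diffF in ws0 *; nra.
Qed.

(** For m = 0, F(t) - F(t/2) is t/2 times a value of F' that is at least F'(t)/C. In the inductive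
    step, t F'' <= C1 F' gives (t F')' <= (1 + C1) F', which is integrated from [t1]; the boundary
    term [D] is absorbed because [F] increases. *)
Lemma slow_class_growth m t0 C F : 1 <= t0 -> 0 <= C -> slow_class m t0 C F ->
  exists C' t1, [/\ t0 <= t1, 0 <= C' & forall t, t1 <= t -> t * F 1%N t <= C' * F 0%N t].
Proof.
move=> t01 C0; elim: m F => [|m IH] F [Fd Fpos Fle Fdec].
  exists (2 * C), (2 * t0); split; [by move: t01; ilra | by rewrite mulr_ge0 | move=> t tt].
  have t2 : t0 <= t / 2 by move: tt; ilra.
  have t2t : t / 2 <= t by move: tt t01; ilra.
  have [r /andP[tr rt] E] := mean_value (fun r => Fd 0%N r isT) t2 t2t.
  have := Fdec r t (le_trans t2 tr) rt.
  have := Fpos 0%N _ isT t2.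
  have tp : 0 < t by move: tt t01; ilra.
  move: E; rewrite (_ : t - t / 2 = t / 2); last by field.
  move=> E F0 h; have := ler_wpM2l (ltW tp) h.
  have : F 1%N r * (t / 2) <= F 0%N t by rewrite -E lerBlDr lerDl ltW.
  by move=> /(ler_wpM2l C0); ilra.
have [|C1 [t1 [t0t1 C10 h1]]] := IH (fun k => F k.+1).
  by split => // k t km; [exact: Fd | exact: Fpos].
have t1p : 0 <= t1 by move: t0t1 t01; ilra.
pose D := t1 * F 1%N t1; have F1 : 0 < F 0%N t1 by exact: Fpos.
have D0 : 0 <= D by rewrite mulr_ge0 // ltW // Fpos.
exists (1 + C1 + D / F 0%N t1), t1; split => //.
  by rewrite !addr_ge0 ?divr_ge0 ?(ltW F1).
move=> t tt.
pose G r := (1 + C1) * F 0%N r - r * F 1%N r.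
pose dG r := C1 * F 1%N r - r * F 2%N r.
have Gd r : t1 <= r -> is_derive r 1 G (dG r).
  move=> rt; have rt0 := le_trans t0t1 rt.
  have d0 := Fd 0%N r isT rt0; have d1 := Fd 1%N r isT rt0.
  have -> : dG r = (1 + C1) *: F 1%N r - (r *: F 2%N r + F 1%N r *: 1).
    by rewrite /dG /GRing.scale /=; ring.
  exact: is_deriveB.
have [r /andP[tr rt] E] := mean_value Gd (lexx _) tt.
have : 0 <= dG r * (t - t1) by rewrite mulr_ge0 ?subr_ge0 // h1.
rewrite -E /G -/D => h2.
have : D <= D / F 0%N t1 * F 0%N t.
  have F0t : F 0%N t1 <= F 0%N t.
    have [q /andP[tq _] E'] := mean_value (fun r => Fd 0%N r isT) t0t1 tt.
    by rewrite -subr_ge0 E' mulr_ge0 ?subr_ge0 // ltW // Fpos // (le_trans t0t1).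
  by rewrite mulrAC ler_pdivlMr // ler_wpM2l.
move: h2; have : 0 <= (1 + C1) * F 0%N t1 by rewrite mulr_ge0 ?(ltW F1) ?addr_ge0.
ilra.
Qed.

End SlowClass.

Section SlowClassSequences.
Context {R : realType}.
Implicit Types (F : nat -> R -> R) (C t : R).

Lemma slow_class_le m t0 C F s t : slow_class m t0 C F ->
  t0 <= s -> s <= t -> F 0%N s <= F 0%N t.
Proof.
move=> [Fd Fpos _ _] ss st.
have [q /andP[sq _] E] := mean_value (fun r => Fd 0%N r isT) ss st.
by rewrite -subr_ge0 E mulr_ge0 ?subr_ge0 // ltW // Fpos // (le_trans ss).
Qed.

(** For m > 0 the first derivative increases, so growth is at least linear. For m = 0, F' >= F/(C t)
    makes [F] gain at least F(t0)/(2 C) on each dyadic interval [u, 2u]. *)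
Lemma slow_class_unbounded m t0 C F (n0 : nat) : 1 <= t0 -> 0 <= C ->
  slow_class m t0 C F -> forall B : R, exists2 n : nat, (n0 <= n)%N & B <= F 0%N n%:R.
Proof.
move=> t01 C0 Fs B; have := Fs => -[Fd Fpos Fle Fdec].
suff [c c0 [u uP]] : exists2 c, 0 < c & exists u : nat -> R,
    forall j, t0 <= u j /\ j%:R * c <= F 0%N (u j).
  have [j jB] := nat_gt (B / c); have [tu cu] := uP j.
  have [n nu] := nat_gt (u j).
  exists (maxn n0 n); first exact: leq_maxl.
  apply: le_trans (_ : j%:R * c <= _); first by rewrite -ler_pdivrMr // ltW.
  apply: (le_trans cu); apply: (slow_class_le Fs tu).
  by rewrite (le_trans (ltW nu)) // ler_nat leq_maxr.
have F0 : 0 < F 0%N t0 by exact: Fpos.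
have tp : 0 < t0 by move: t01; ilra.
case: m Fs Fd Fpos Fle Fdec => [|m] Fs Fd Fpos Fle Fdec; last first.
  have F1 : 0 < F 1%N t0 by exact: Fpos.
  exists (F 1%N t0) => //; exists (fun j => t0 + j%:R) => j.
  have t0j : t0 <= t0 + j%:R by rewrite lerDl.
  split => //.
  have [q /andP[tq _] E] := mean_value (fun r => Fd 0%N r isT) (lexx _) t0j.
  have [w /andP[tw _] E'] := mean_value (fun r => Fd 1%N r isT) (lexx _) tq.
  have Fq : F 1%N t0 <= F 1%N q.
    by rewrite -subr_ge0 E' mulr_ge0 ?subr_ge0 // ltW // Fpos.
  rewrite -[leRHS](subrK (F 0%N t0)) E (_ : t0 + j%:R - t0 = j%:R); last by ring.
  by apply: le_trans (_ : F 1%N q * j%:R <= _); [rewrite mulrC ler_wpM2r | rewrite lerDl ltW].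
have C1 : 0 < C.
  rewrite lt_neqAle C0 andbT; apply/eqP => C00.
  by have := Fle _ (lexx t0); rewrite -C00 !mul0r leNgt F0.
exists (F 0%N t0 / (2 * C)); first by rewrite divr_gt0 // mulr_gt0.
exists (fun j => t0 * 2 ^+ j); elim=> [|j [tj jP]].
  by rewrite expr0 mulr1 mul0r; split => //; exact: ltW.
set u := t0 * 2 ^+ j in tj jP *.
have -> : t0 * 2 ^+ j.+1 = 2 * u by rewrite exprS /u; ring.
have up : 0 < u by move: tj; ilra.
have u2 : u <= 2 * u by ilra.
split; first exact: le_trans tj u2.
have [q /andP[uq qu] E] := mean_value (fun r => Fd 0%N r isT) tj u2.
have tq := le_trans tj uq.
have h1 := Fle q tq; have h2 := slow_class_le Fs (lexx t0) tq.
have F1q : 0 < F 1%N q by exact: Fpos.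
rewrite -natr1 mulrDl mul1r -[leRHS](subrK (F 0%N u)) E addrC; apply: lerD => //.
rewrite ler_pdivrMr ?mulr_gt0 //; apply: (le_trans h2); apply: (le_trans h1).
have -> : F 1%N q * (2 * u - u) * (2 * C) = C * (2 * u) * F 1%N q by ring.
by apply: ler_wpM2r; [exact: ltW | exact: ler_wpM2l].
Qed.

(** A Gronwall bound: the logarithmic derivative F'/F is at most C'/r, hence at most C'/K beyond
    [K]. *)
Lemma slow_class_ratio m t0 C F (C' t1 : R) K t : slow_class m t0 C F ->
  1 <= t0 -> t0 <= t1 -> 0 <= C' ->
  (forall r, t1 <= r -> r * F 1%N r <= C' * F 0%N r) ->
  t1 <= K -> K <= t -> F 0%N t <= F 0%N K * expR (C' * ((t - K) / K)).
Proof.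
move=> [Fd Fpos Fle Fdec] t01 t0t1 C0 h tK Kt.
have Kp : 0 < K by move: tK t0t1 t01; ilra.
have F0 r : t1 <= r -> 0 < F 0%N r by move=> tr; apply: Fpos => //; exact: le_trans tr.
have lnd r : t1 <= r -> is_derive r 1 (@ln R \o F 0%N) ((F 0%N r)^-1 * F 1%N r).
  move=> tr; have d0 := Fd 0%N r isT (le_trans t0t1 tr).
  exact: (@is_derive1_comp _ _ _ _ _ _ (is_derive1_ln (F0 _ tr)) d0).
have [q /andP[Kq qt] /= E] := mean_value lnd tK Kt.
have tq := le_trans tK Kq.
rewrite -ler_ln ?posrE ?mulr_gt0 ?expR_gt0 ?F0 ?(le_trans tK Kt) //.
rewrite lnM ?posrE ?expR_gt0 ?F0 // expRK -lerBlDl E.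
rewrite -[leRHS](_ : C' / K * (t - K) = _); last by rewrite mulrAC -!mulrA.
apply: ler_wpM2r; first by rewrite subr_ge0.
rewrite mulrC ler_pdivrMr ?F0 // mulrAC ler_pdivlMr // mulrC.
apply: le_trans (h _ tq); apply: ler_wpM2r Kq.
by rewrite ltW // Fpos // (le_trans t0t1).
Qed.

End SlowClassSequences.

(** * Integer parts of functions of class P_m are null *)

Section SlowClassNull.
Context {R : realType} {H : normedModType R[i]}.
Context (dotp : {dot H for Num.conj}).
Hypothesis dotpE : forall x : H, `|x| ^+ 2 = dotp x x.
Context (T : {linear H -> H}) (M : R).
Hypothesis M0 : 0 <= M.
Hypothesis TM : forall n u, rnorm (iter n T u) <= M * rnorm u.
Variable x : H.
Hypothesis idnull : weighted_null T x id.

Lemma weighted_null_slow_class0 t0 C (F : nat -> R -> R) :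
  1 <= t0 -> 0 <= C -> slow_class 0 t0 C F ->
  weighted_null T x (fun n => Num.trunc (F 0%N n%:R)).
Proof.
move=> t01 C0 Fs; have := Fs => -[Fd Fpos Fle Fdec].
have [n0 n0P] := nat_gt t0.
have tn n : (n0 <= n)%N -> t0 <= n%:R by move=> n0n; rewrite (le_trans (ltW n0P)) // ler_nat.
have F1 : 0 < F 1%N t0 by exact: Fpos.
have F00 : 0 < F 0%N t0 by exact: Fpos.
have C1 : 1 <= C by have := Fdec _ _ (lexx t0) (lexx _); rewrite ler_pMl.
have Cp : 0 < C by apply: lt_le_trans C1.
(* With slope F'(N)/C, the product (1 + C/F'(N)) (F(N) + 1) has four terms; the summands of [A]
   bound F, 1, C F/F' and C/F' in this order, each divided by N. *)
pose A := C ^+ 2 * F 1%N t0 + 1 + C ^+ 2 + C ^+ 2 / F 0%N t0.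
apply: (@weighted_null_slow _ _ T M M0 TM x (fun n => F 0%N n%:R)
   (fun n => F 1%N n%:R / C) A n0) => //.
- move=> n N /andP[n0n nN]; rewrite (slow_class_le Fs (tn _ n0n)) ?ler_nat // andbT.
  by rewrite ltW // Fpos // tn.
- exact: slow_class_unbounded Fs.
- by move=> N n0N; rewrite divr_gt0 // Fpos // tn.
- move=> n n' N n0n /andP[nn' n'N].
  have [|q /andP[nq qn] E] := mean_value (fun r => Fd 0%N r isT) (tn _ n0n) (t := n'%:R).
    by rewrite ler_nat.
  rewrite E natrB // mulrC; apply: ler_wpM2r; first by rewrite subr_ge0 ler_nat.
  rewrite ler_pdivrMr // mulrC; apply: Fdec; first by rewrite (le_trans (tn _ n0n)).
  by rewrite (le_trans qn) // ler_nat ltnW.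
move=> N n0N; have tN := tn _ n0N.
have FN1 : 0 < F 1%N N%:R by exact: Fpos.
have FN0 : 0 < F 0%N N%:R by exact: Fpos.
have h1 := Fle _ tN; have h2 := Fdec _ _ (lexx t0) tN.
have h3 := slow_class_le Fs (lexx t0) tN.
have N1 : 1 <= N%:R :> R := le_trans t01 tN.
have NR : 0 <= N%:R :> R by [].
have i1 : F 0%N N%:R <= C ^+ 2 * F 1%N t0 * N%:R.
  apply: (le_trans h1); apply: le_trans (ler_wpM2l (mulr_ge0 C0 NR) h2) _.
  by rewrite le_eqVlt; apply/orP; left; apply/eqP; ring.
have i2 : C / F 1%N N%:R * F 0%N N%:R <= C ^+ 2 * N%:R.
  rewrite mulrAC ler_pdivrMr // expr2 -!mulrA ler_pM2l //; move: h1; rewrite -mulrA //.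
have i3 : C / F 1%N N%:R <= C ^+ 2 / F 0%N t0 * N%:R.
  rewrite ler_pdivrMr // mulrAC mulrAC -mulrA mulrAC ler_pdivlMr //.
  rewrite expr2 -!mulrA ler_pM2l // (le_trans h3) // (le_trans h1) //.
  by rewrite le_eqVlt; apply/orP; left; apply/eqP; ring.
rewrite invf_div; move: i1 i2 i3; move: (C / F 1%N N%:R) (C ^+ 2 / F 0%N t0) @A => u v A.
by rewrite /A; nra.
Qed.

Theorem weighted_null_slow_class m t0 C (F : nat -> R -> R) :
  1 <= t0 -> 0 <= C -> slow_class m t0 C F ->
  weighted_null T x (fun n => Num.trunc (F 0%N n%:R)).
Proof.
elim: m t0 C F => [|m IH] t0 C F t01 C0 Fs; first exact: weighted_null_slow_class0 Fs.
have := Fs => -[Fd Fpos Fle Fdec].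
have [n0 n0P] := nat_gt t0.
have tn n : (n0 <= n)%N -> t0 <= n%:R by move=> n0n; rewrite (le_trans (ltW n0P)) // ler_nat.
have Fn0 n : (n0 <= n)%N -> 0 <= F 0%N n%:R by move=> /tn tt; rewrite ltW // Fpos.
have Fle_nat n h : (n0 <= n)%N -> F 0%N n%:R <= F 0%N (n + h)%:R.
  by move=> /tn tt; apply: (slow_class_le Fs tt); rewrite ler_nat leq_addr.
apply: (van_der_corput dotpE M0 TM (n0 := n0)).
- by move=> n h n0n; apply: le_truncn; exact: Fle_nat.
- move=> h h0; apply: (@weighted_null_trunc_diff _ _ T M M0 TM x (fun n => F 0%N n%:R) n0).
    by move=> n n0n; rewrite Fn0 //= Fle_nat.
  have hR : 0 < h%:R :> R by rewrite ltr0n.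
  have := IH _ _ _ _ _ (slow_class_diff hR t01 C0 Fs).
  have -> : (fun n : nat => Num.trunc (F 0%N (n + h)%:R - F 0%N n%:R)) =
    (fun n : nat => Num.trunc (diffF h%:R F 0%N n%:R)).
    by apply/funext => n; rewrite /diffF natrD.
  by apply; [move: t01 hR; ilra | rewrite addr_ge0 ?mulr_ge0].
move=> k Q eta eta0.
have [C' [t1 [t0t1 C'0 gr]]] := slow_class_growth t01 C0 Fs.
(* Bounds F(q)/F(K) for K <= q <= K (k + Q), an interval containing every mean value point between
   [n] and n + Q. *)
pose D := expR (C' * (k + Q)%:R).
have D0 : 0 < D by exact: expR_gt0.
have [n1 n1P] := nat_gt t1.
have [n2 n2P] := nat_gt (Q%:R * C' * D / (eta / 4)).
(* F(K) >= 2 ensures that the integer part is at least F(K)/2, and the summand 4/eta pays for the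
   error 1 from rounding the difference. *)
have [n3 n03 n3P] := slow_class_unbounded n0 t01 C0 Fs (2 + 4 / eta).
exists (maxn (maxn n0 n1) (maxn n2 n3).+1) => K.
rewrite !geq_max => /andP[/andP[n0K n1K]]; rewrite gtn_max => /andP[n2K n3K].
have tK := tn _ n0K.
have t1K : t1 <= K%:R by rewrite (le_trans (ltW n1P)) // ler_nat.
have KR : 0 < K%:R :> R by rewrite ltr0n (leq_ltn_trans _ n2K).
have FK : 2 + 4 / eta <= F 0%N K%:R.
  by rewrite (le_trans n3P) // (slow_class_le Fs (tn _ n03)) // ler_nat ltnW.
have e4 : 0 < 4 / eta by rewrite divr_gt0.
have FK0 : 0 <= F 0%N K%:R by exact: Fn0.
have /andP[aK1 aK2] := truncn_itv FK0.
split; first by rewrite truncn_gt0; move: FK e4; ilra.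
move=> n /andP[Kn nkK].
have n0n := leq_trans n0K Kn.
have nnQ : n%:R <= (n + Q)%:R :> R by rewrite ler_nat leq_addr.
have [q /andP[nq qn] E] := mean_value (fun r => Fd 0%N r isT) (tn _ n0n) nnQ.
have Kq : K%:R <= q by rewrite (le_trans _ nq) // ler_nat.
have qp : 0 < q := lt_le_trans KR Kq.
have qkQ : q <= K%:R * (k + Q)%:R.
  rewrite (le_trans qn) // -natrM ler_nat mulnDr leq_add //.
    by rewrite mulnC ltnW.
  by rewrite leq_pmull // (leq_ltn_trans _ n2K).
have Fq : F 0%N q <= F 0%N K%:R * D.
  apply: le_trans (slow_class_ratio Fs t01 t0t1 C'0 gr t1K Kq) _.
  apply: ler_wpM2l => //; rewrite ler_expR; apply: ler_wpM2l => //.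
  by rewrite ler_pdivrMr // mulrC (le_trans _ qkQ) // lerBlDr lerDl ltW.
have diff : F 0%N (n + Q)%:R - F 0%N n%:R <= eta / 4 * F 0%N K%:R.
  rewrite E natrD (_ : n%:R + Q%:R - n%:R = Q%:R); last by ring.
  have g := gr q (le_trans t1K Kq).
  have g1 : F 1%N q <= C' * (F 0%N K%:R * D) / K%:R.
    rewrite ler_pdivlMr // mulrC.
    apply: le_trans (_ : q * F 1%N q <= _); first by rewrite ler_wpM2r // ltW // Fpos // (le_trans tK).
    by apply: (le_trans g); exact: ler_wpM2l.
  apply: le_trans (ler_wpM2r (ler0n _ Q) g1) _.
  have g2 : Q%:R * C' * D <= eta / 4 * K%:R.
    rewrite [leRHS]mulrC -ler_pdivrMr ?divr_gt0 // (le_trans (ltW n2P)) //.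
    by rewrite ler_nat ltnW.
  have g3 := ler_wpM2r FK0 g2.
  rewrite mulrAC ler_pdivrMr // [leRHS]mulrAC; apply: le_trans g3.
  by rewrite le_eqVlt; apply/orP; left; apply/eqP; ring.
have b1 : (Num.trunc (F 0%N (n + Q)%:R) - Num.trunc (F 0%N n%:R))%:R <=
   F 0%N (n + Q)%:R - F 0%N n%:R + 1.
  rewrite natrB; last by apply: le_truncn; exact: Fle_nat.
  have /andP[u1 u2] := truncn_itv (Fn0 _ n0n).
  have u3 : (Num.trunc (F 0%N (n + Q)%:R))%:R <= F 0%N (n + Q)%:R.
    by rewrite truncn_le Fn0 // (leq_trans n0n) // leq_addr.
  by move: u2 u3; rewrite -natr1; ilra.
apply: (le_trans b1).
have b2 : 1 <= eta / 4 * (F 0%N K%:R - 2).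
  rewrite mulrC -ler_pdivrMr ?divr_gt0 // invf_div mul1r; move: FK; ilra.
have b3 : F 0%N K%:R / 2 <= (Num.trunc (F 0%N K%:R))%:R.
  by move: aK2 FK e4; rewrite -natr1; ilra.
have := ler_wpM2l (ltW eta0) b3.
move: diff b2 eta0; ilra.
Qed.

End SlowClassNull.

(** * From the definitions of the statement to the estimates *)

Section Reduction.
Context {R : realType}.

Lemma ltpinfty_real_bound (S : \bar R) : (S < +oo)%E ->
  exists2 B : R, 1 <= B & (S <= B%:E)%E.
Proof.
case: S => [r _| //|_]; last by exists 1; rewrite ?leNye.
by exists (Num.max 1 r); rewrite ?lee_fin le_max lexx ?orbT.
Qed.

Lemma limf_esup_bound (h : R -> \bar R) :
  (limf_esup h (pinfty_nbhs R) < +oo)%E ->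
  exists2 B : R, 1 <= B & exists t0 : R, forall t, t0 < t -> (h t <= B%:E)%E.
Proof.
move=> /ereal_inf_lt [_ [V [t0 [_ Vt0]] <-]] /ltpinfty_real_bound [B B1 VB].
exists B => //; exists t0 => t /Vt0 Vt; apply: le_trans VB.
by apply: ereal_sup_ubound; exists t.
Qed.

Lemma class_P_slow m t0 (f : R -> R) : class_P m.+1 t0 f ->
  exists t1 C, [/\ t0 <= t1, 1 <= t1, 0 <= C &
    slow_class m t1 C (fun k => derive1n k f)].
Proof.
move=> [_ [s1 [_ fs1]] /limf_esup_bound [B B1 [s2 fs2]] /limf_esup_bound [B' B1' [s3 fs3]]].
pose s4 := Num.max (Num.max t0 1) (Num.max s1 (Num.max s2 s3)).
pose t1 := s4 + 1; pose C := Num.max B B'.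
have gt t : t1 <= t -> [/\ t0 < t, 1 < t, s1 < t, s2 < t & s3 < t].
  move=> tt; have : s4 < t by apply: lt_le_trans tt; rewrite ltrDl.
  by rewrite !gt_max => /andP[/andP[-> ->] /and3P[-> -> ->]].
have [a1 a2 _ _ _] := gt t1 (lexx _).
have BC : B <= C by rewrite le_max lexx.
have BC' : B' <= C by rewrite le_max lexx orbT.
exists t1, C; split; rewrite ?(ltW a1) ?(ltW a2) //.
  by rewrite (le_trans _ BC) // (le_trans ler01).
have fpos k t : (k <= m.+1)%N -> t1 <= t -> 0 < derive1n k f t.
  by move=> km /gt[_ _ /fs1[_ h] _ _]; case: (h k km).
split => //.
- move=> k t km /gt[_ _ /fs1[h _] _ _].
  by have /derivableP := h k km; rewrite derive1nS derive1E.
- move=> t tt; have [_ t1' _ /fs2 h _] := gt t tt.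
  have tp : 0 < t by apply: lt_trans t1'.
  have : ((derive1n m f t / (t * derive1n m.+1 f t))%:E <= B%:E)%E := h.
  have fm := fpos m.+1 t (leqnn _) tt.
  rewrite lee_fin ler_pdivrMr ?mulr_gt0 // => {}h.
  by apply: (le_trans h); rewrite -mulrA; apply: ler_wpM2r => //; rewrite ltW // mulr_gt0.
- move=> s t ss st; have [_ _ _ _ /fs3 h] := gt s ss.
  have : ((derive1n m.+1 f t / derive1n m.+1 f s)%:E <= B'%:E)%E.
    apply: le_trans h; apply: ereal_sup_ubound; exists t => //=.
    by rewrite in_itv /= st.
  rewrite lee_fin ler_pdivrMr ?fpos // => h'.
  by apply: (le_trans h'); apply: ler_wpM2r => //; exact/ltW/fpos.
Qed.

Context {H : normedModType R[i]}.

Lemma power_bounded_rnorm (T : {linear H -> H}) : power_bounded T ->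
  exists2 M : R, 0 <= M & forall n u, rnorm (iter n T u) <= M * rnorm u.
Proof.
move=> /ltpinfty_real_bound [M M1 TM]; exists M => [|n u]; first exact: le_trans M1.
have [->|u0] := eqVneq u 0; first by rewrite iter_lin0 rnorm0 mulr0.
have nu : 0 < rnorm u.
  by rewrite lt_neqAle rnorm_ge0 eq_sym andbT; apply: contra_neq u0; exact: rnorm0_eq0.
pose v := ((rnorm u)^-1)%:C *: u.
have : rnorm (iter n T v) <= M.
  rewrite -lee_fin; apply: le_trans TM.
  apply: (@le_trans _ _ (opnorm (iter n T))); last first.
    by apply: ereal_sup_ubound; exists n.
  apply: ereal_sup_ubound; exists v => //=.
  rewrite -[X in _ <= X]/(1%:C) -rnorm_le rnormZr ?invr_ge0 ?rnorm_ge0 //.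
  by rewrite mulVf // gt_eqF.
by rewrite iter_linZ rnormZr ?invr_ge0 ?rnorm_ge0 // mulrC ler_pdivrMr.
Qed.

Lemma no_fixed_rotation (T : {linear H -> H}) :
  point_spectrum T `&` unit_circle = set0 ->
  forall (c : R[i]) u, rnorm c = 1 -> c *: T u = u -> u = 0.
Proof.
move=> Tspec c u c1 cTu; apply/eqP/negPn/negP => u0.
have c0 : c != 0 by apply/eqP => c00; move: c1; rewrite c00 rnorm0 => /eqP; rewrite eq_sym oner_eq0.
have : (point_spectrum T `&` unit_circle) c^-1.
  split; last by rewrite /unit_circle /= normfV rnormE c1 rmorph1 invr1.
  by exists u => //; rewrite -{2}cTu scalerA mulVf // scale1r.
by rewrite Tspec.
Qed.

Lemma rnorm_weight t1 (g : R -> R) n : rnorm (weight t1 g n) <= 1.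
Proof. by rewrite /weight; case: ifP; rewrite ?rnorm_expi2pi ?rnorm1. Qed.

(** [Num.trunc] is 0 at negative reals, so both conventions, for negative exponents and outside the
    domain of [f], become the exponent 0. *)
Lemma floor_powerE (T : H -> H) t0 (f : R -> R) n x :
  floor_power T t0 f n x =
  iter (if t0 <= n%:R then Num.trunc (f n%:R) else 0%N) T x.
Proof.
by rewrite /floor_power; case: ifP => // _; rewrite truncEfloor; case: Num.floor.
Qed.

End Reduction.

Theorem theorem3p10 (R : realType)
  (H : completeNormedModType R[i]) (dotp : {dot H for Num.conj})
  (dotpE : forall x : H, `|x| ^+ 2 = dotp x x)
  (T : {linear H -> H}) (T_pb : power_bounded T)
  (T_spec : point_spectrum T `&` unit_circle = set0)
  (t1 : R) (g : R -> R) (g_cont : {within `[t1, +oo[, continuous g})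
  (g_Q : property_Q t1 g)
  (m : nat) (m_gt0 : (0 < m)%N) (t0 : R) (f : R -> R) (f_P : class_P m t0 f)
  (x : H) :
  (N%:R^-1 : R[i]) *: (\sum_(1 <= n < N.+1)
      weight t1 g n *: floor_power T t0 f n x) @[N --> \oo] --> (0 : H).
Proof.
case: m m_gt0 f_P => // m _ /class_P_slow [s [C [ts s1 C0 fs]]].
have [M M0 TM] := power_bounded_rnorm T_pb.
have T_fix := no_fixed_rotation T_spec.
have idnull := weighted_null_id dotpE M0 TM T_fix x.
have fnull := weighted_null_slow_class dotpE M0 TM idnull s1 C0 fs.
pose a n := if t0 <= n%:R then Num.trunc (f n%:R) else 0%N.
have anull : weighted_null T x a.
  have [n0 n0P] := nat_gt s.
  apply: (weighted_null_succ M0 TM (n0 := n0) fnull) => n n0n; left.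
  rewrite /a ifT // (le_trans ts) // (le_trans (ltW n0P)) // ler_nat //.
apply/cvgr0Pnorm_le => e e0.
have er : e = (complex.Re e)%:C by rewrite RRe_real // gtr0_real.
have er0 : 0 < complex.Re e / 2 by rewrite divr_gt0 // -ltcR -er.
have [N0 N0P] := weighted_null_pred anull er0.
exists N0.+1 => // N /= NN.
rewrite er -rnorm_le -(rmorph_nat (real_complex R)) -fmorphV rnormZr ?invr_ge0 //.
have N1 : (0 < N)%N by apply: leq_trans NN.
rewrite ler_pdivrMl ?ltr0n //.
(* The range 1..N is 0..N with the index 0 removed by the predicate; N + 1 <= 2 N explains the
   choice of half of [e]. *)
have := N0P N.+1 (ltnW (leqW NN)) (fun n => 0 < n)%N _ (rnorm_weight t1 g).
under eq_bigr do rewrite floor_powerE.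
rewrite (big_nat_widenl 1 0) //= => h; apply: (le_trans h).
have NR : 1 <= N%:R :> R by rewrite ler1n.
by rewrite -[N.+1%:R]natr1; move: er0 NR; nra.
Qed.
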